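(* $\mathsf{INF}[\mathsf{Prop}(\wedge)]$ is in $\mathsf{P}$ when the query $(\mathbf{Q},\mathbf{E})$ contains only positive assignments, and $\mathsf{INF}[\mathsf{Prop}(\vee)]$ is in $\mathsf{P}$ when the query $(\mathbf{Q},\mathbf{E})$ contains only negative assignments.
   Context: A (propositional) Bayesian network specification $\mathbb{B}$ over binary random variables $X_1,\dots,X_n$ (each identified with a proposition, of which it is the $0/1$ indicator) associates with each $X_i$ either a definition axiom, that is a logical equivalence $X_i \leftrightarrow \ell_i$ whose body $\ell_i$ is a propositional formula in a language $\mathcal{L}$ over the propositions $X_1,\dots,X_n$, or a probabilistic assessment $\mathbb{P}(X_i=1)=\alpha$ with $\alpha$ a rational number in $[0,1]$. The directed graph with an edge from $X_j$ to $X_i$ whenever $X_j$ appears in $\ell_i$ is assumed acyclic. The specification defines a joint distribution $\mathbb{P}$: variables with assessments are mutually independent with the given probabilities, and the other variables are determined by the definition axioms. An assignment is an event $\{X=1\}$ (positive) or $\{X=0\}$ (negative). A query is a pair $(\mathbf{Q},\mathbf{E})$ of sets of assignments. $\mathsf{INF}[\mathcal{L}]$ is the language of strings $(\mathbb{B},\mathbf{Q},\mathbf{E},\gamma)$, with $\mathbb{B}$ a specification whose definition axioms have bodies in $\mathcal{L}$ and $\gamma$ a rational number in $[0,1]$, such that $\mathbb{P}(\mathbf{Q}|\mathbf{E})=\mathbb{P}(\mathbf{Q},\mathbf{E})/\mathbb{P}(\mathbf{E})>\gamma$. $\mathsf{Prop}(\nu)$ denotes the propositional formulas whose only operators are those in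 the list $\nu$; thus $\mathsf{Prop}(\wedge)$ uses only conjunction and $\mathsf{Prop}(\vee)$ only disjunction. *)

(* Defs.v *)
From Corelib Require Import BinNums.
From HB Require Import structures.
From mathcomp Require Import all_boot all_order all_algebra.

Set Implicit Arguments.
Unset Strict Implicit.
Unset Printing Implicit Defensive.

Import Order.TTheory GRing.Theory Num.Theory.

Inductive move := GoLeft | Stay | GoRight.

(* A two-way infinite tape: the cells to the left of the head (nearest first),
   the scanned cell, and the cells to its right (nearest first).  All the cells
   beyond the two lists are blank. *)
Record tape (C : Type) := Tape { lcells : seq C; scanned : C; rcells : seq C }.

Definition shift (C : Type) (blank : C) (d : move) (t : tape C) : tape C :=
  let: Tape l c r := t in
  match d with
  | GoLeft => Tape (behead l) (head blank l) (c :: r)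
  | Stay => t
  | GoRight => Tape (c :: l) (head blank r) (behead r)
  end.

Definition write (C : Type) (c : C) (t : tape C) : tape C :=
  Tape (lcells t) c (rcells t).

(* The tape symbols are the input symbols (S), further work symbols, and the
   blank (None).  The transition table is only consulted in states that are not
   halting. *)
Record turing_machine (S : finType) := TuringMachine {
  last_tape : nat;
  work_symbol : finType;
  state : finType;
  start : state;
  halting : pred state;
  accepting : pred state;
  transition : state -> {ffun 'I_last_tape.+1 -> option (S + work_symbol)} ->
    state * {ffun 'I_last_tape.+1 -> option (S + work_symbol) * move}
}.

Definition cell (S : finType) (M : turing_machine S) : Type :=
  option (S + work_symbol M).

Record config (S : finType) (M : turing_machine S) := Config {
  control : state M;
  tapes : {ffun 'I_(last_tape M).+1 -> tape (cell M)}
}.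

(* The input is written on tape 0, with the head on its first symbol. *)
Definition initial (S : finType) (M : turing_machine S) (s : seq S) : config M :=
  let input : seq (cell M) := [seq Some (inl a) | a <- s] in
  Config (start M)
    [ffun i => if i == ord0 then Tape [::] (head None input) (behead input)
               else Tape [::] None [::]].

Definition step (S : finType) (M : turing_machine S) (c : config M) : config M :=
  if halting (control c) then c else
  let: (q, act) := transition (control c) [ffun i => scanned (tapes c i)] in
  Config q [ffun i => shift None (act i).2 (write (act i).1 (tapes c i))].

Definition run (S : finType) (M : turing_machine S) (t : nat) (s : seq S) :
  config M := iter t (@step S M) (initial M s).

Definition in_P (S : finType) (L : seq S -> Prop) : Prop :=
  exists (M : turing_machine S) (p : {poly nat}), forall s : seq S,
    let c := run M (p.[size s])%R s in
    halting (control c) /\ (accepting (control c) <-> L s).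

Inductive connective := Neg | Conj | Disj.

Definition connective_code (o : connective) : 'I_3 :=
  match o with Neg => inord 0 | Conj => inord 1 | Disj => inord 2 end.

Definition connective_decode (k : 'I_3) : connective :=
  nth Neg [:: Neg; Conj; Disj] k.

Lemma connective_codeK : cancel connective_code connective_decode.
Proof. by case; rewrite /connective_decode /= inordK. Qed.

HB.instance Definition _ := Equality.copy connective (can_type connective_codeK).

Inductive formula (n : nat) :=
  | Prp of 'I_n
  | Not of formula n
  | And of formula n & formula n
  | Or of formula n & formula n.

Fixpoint eval (n : nat) (w : 'I_n -> bool) (f : formula n) : bool :=
  match f with
  | Prp i => w i
  | Not g => ~~ eval w g
  | And g h => eval w g && eval w h
  | Or g h => eval w g || eval w h
  end.

Fixpoint props (n : nat) (f : formula n) : seq 'I_n :=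
  match f with
  | Prp i => [:: i]
  | Not g => props g
  | And g h | Or g h => props g ++ props h
  end.

Fixpoint connectives (n : nat) (f : formula n) : seq connective :=
  match f with
  | Prp _ => [::]
  | Not g => Neg :: connectives g
  | And g h => Conj :: connectives g ++ connectives h
  | Or g h => Disj :: connectives g ++ connectives h
  end.

Definition language := forall n : nat, pred (formula n).

Definition Prop_language (nu : seq connective) : language :=
  fun n f => all (mem nu) (connectives f).

(* A rational number in [0,1], presented as a fraction of two natural numbers
   that need not be in lowest terms. *)
Record fraction := Fraction {
  fnum : nat;
  fden : nat;
  _ : (0 < fden) && (fnum <= fden)
}.

Definition value (a : fraction) : rat := ((fnum a)%:R / (fden a)%:R)%R.

Inductive clause (n : nat) :=
  | Definiens of formula n    (* X_i <-> l_i *)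
  | Assess of fraction.       (* P(X_i = 1) = alpha *)

Definition edge (n : nat) (B : 'I_n -> clause n) : rel 'I_n :=
  fun j i => if B i is Definiens f then j \in props f else false.

Definition acyclic (T : finType) (e : rel T) : bool :=
  [forall x, forall y, e x y ==> ~~ connect e y x].

Record specification (n : nat) := Specification {
  clause_of : 'I_n -> clause n;
  _ : acyclic (edge clause_of)
}.

(* The probability that X_i takes its value in w, given the values in w of the
   parents of X_i. *)
Definition local_prob (n : nat) (B : specification n) (w : {ffun 'I_n -> bool})
    (i : 'I_n) : rat :=
  match clause_of B i with
  | Definiens f => ((w i == eval w f)%:R)%R
  | Assess a => (if w i then value a else 1 - value a)%R
  end.

Definition joint (n : nat) (B : specification n) (w : {ffun 'I_n -> bool}) :
  rat := (\prod_(i < n) local_prob B w i)%R.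

Definition Pr (n : nat) (B : specification n) (A : pred {ffun 'I_n -> bool}) :
  rat := (\sum_(w | A w) joint B w)%R.

(* (i, b) is the assignment {X_i = b}.  A set of assignments is presented by a
   list, whose order and repetitions are irrelevant. *)
Definition assignment (n : nat) : Type := ('I_n * bool)%type.

Definition event (n : nat) (A : seq (assignment n)) :
  pred {ffun 'I_n -> bool} := fun w => all (fun a => w a.1 == a.2) A.

Record instance := Instance {
  nvars : nat;
  spec : specification nvars;
  query : seq (assignment nvars);
  evidence : seq (assignment nvars);
  threshold : fraction
}.

Definition bodies_in (L : language) (n : nat) (B : specification n) : Prop :=
  forall i f, clause_of B i = Definiens f -> L n f.

(* The conditional probability is undefined, and the instance negative, when
   the evidence has probability zero. *)
Definition INF (L : language) (x : instance) : Prop :=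
  let pE := Pr (spec x) (event (evidence x)) in
  let pQE := Pr (spec x) (predI (event (query x)) (event (evidence x))) in
  [/\ bodies_in L (spec x), (0 < pE)%R & (value (threshold x) < pQE / pE)%R].

Definition only_assigns (b : bool) (x : instance) : bool :=
  all (fun a => a.2 == b) (query x ++ evidence x).

Inductive symbol :=
  | Bit0 | Bit1 | SEnd
  | SPrp | SNot | SAnd | SOr
  | SDefiniens | SAssess
  | SAssign | SSection.

Definition symbol_list : seq symbol :=
  [:: Bit0; Bit1; SEnd; SPrp; SNot; SAnd; SOr; SDefiniens; SAssess; SAssign;
      SSection].

Definition symbol_code (a : symbol) : 'I_11 :=
  match a with
  | Bit0 => inord 0 | Bit1 => inord 1 | SEnd => inord 2
  | SPrp => inord 3 | SNot => inord 4 | SAnd => inord 5 | SOr => inord 6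
  | SDefiniens => inord 7 | SAssess => inord 8
  | SAssign => inord 9 | SSection => inord 10
  end.

Definition symbol_decode (k : 'I_11) : symbol := nth Bit0 symbol_list k.

Lemma symbol_codeK : cancel symbol_code symbol_decode.
Proof. by case; rewrite /symbol_decode /= inordK. Qed.

HB.instance Definition _ := Finite.copy symbol (can_type symbol_codeK).

Definition encode_bit (b : bool) : symbol := if b then Bit1 else Bit0.

Fixpoint encode_positive (p : positive) : seq symbol :=
  match p with
  | xH => [:: Bit1]
  | xO q => Bit0 :: encode_positive q
  | xI q => Bit1 :: encode_positive q
  end.

(* Binary numerals, least significant bit first, without redundant zeros (zero
   is the empty numeral), closed by SEnd. *)
Definition encode_nat (m : nat) : seq symbol :=
  (if bin_of_nat m is Npos p then encode_positive p else [::]) ++ [:: SEnd].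

Definition encode_fraction (a : fraction) : seq symbol :=
  encode_nat (fnum a) ++ encode_nat (fden a).

(* Polish notation. *)
Fixpoint encode_formula (n : nat) (f : formula n) : seq symbol :=
  match f with
  | Prp i => SPrp :: encode_nat i
  | Not g => SNot :: encode_formula g
  | And g h => SAnd :: encode_formula g ++ encode_formula h
  | Or g h => SOr :: encode_formula g ++ encode_formula h
  end.

Definition encode_clause (n : nat) (c : clause n) : seq symbol :=
  match c with
  | Definiens f => SDefiniens :: encode_formula f
  | Assess a => SAssess :: encode_fraction a
  end.

Definition encode_assignment (n : nat) (a : assignment n) : seq symbol :=
  SAssign :: encode_bit a.2 :: encode_nat a.1.

(* The clauses come in the order of their variables, which they therefore need
   not name. *)
Definition encode (x : instance) : seq symbol :=
  flatten [seq encode_clause (clause_of (spec x) i) | i <- enum 'I_(nvars x)]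
    ++ SSection :: flatten [seq encode_assignment a | a <- query x]
    ++ SSection :: flatten [seq encode_assignment a | a <- evidence x]
    ++ SSection :: encode_fraction (threshold x).

Definition strings (A : instance -> Prop) : seq symbol -> Prop :=
  fun s => exists2 x, encode x = s & A x.

(* Main.v *)
(* If all the bodies are conjunctions and X_i = 1 with positive probability, then
   all the ancestors of X_i are 1 as well, and this is the only constraint; hence
   the probability of a set of positive assignments is the product of the
   assessments over the ancestors of its variables.  Dually for disjunctions and
   negative assignments, with 1 - alpha in place of alpha.  P(Q|E) is thus the
   product over the ancestors of Q and E that are not ancestors of E, and it is
   compared with the threshold by cross-multiplying integers.

   Polynomial time is established without writing a Turing machine by hand: the
   functions computed in polynomial time by structured programs acting on a stack
   of serialised trees are closed under composition, pairing, case distinction,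
   and folds over lists in which every step adds to the accumulator at most an
   amount polynomial in the environment and the current element. *)
From Corelib Require Import BinNums.
Require Import Defs.
From mathcomp Require Import all_boot all_order all_algebra.
From mathcomp Require Import zify.

Set Implicit Arguments.
Unset Strict Implicit.
Unset Printing Implicit Defensive.

(** * Structured programs on four stacks, compiled to Turing machines *)

(** Membership in [strings] requires a genuine encoding, so the procedure must also recognise the
    syntax exactly: canonical numerals, valid fractions, Polish formulas over one connective and
    existing variables, acyclicity. A string is cut into chunks and groups, checked, and proved
    equal to the encoding of an instance rebuilt from it. Both halves of the theorem are one
    argument with a boolean parameter [b], the common value of all assignments. The probabilistic
    part uses only that a body takes the value [b] exactly when all its propositions do. The
    obstacle with folds is that a polynomial-time step may double its accumulator, so that iterating
    it would be exponential. The demand for additive growth shapes the arithmetic and the ancestor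
    search: a bound on each new accumulator must contain the old one with coefficient one. Evidence
    of probability zero is rejected by looking for a vanishing weight among the ancestors of E,
    before any comparison is trusted. *)

Inductive reg := W | R | Q | K.

Record regs (A : Type) := Regs { atW : A; atR : A; atQ : A; atK : A }.

Definition get (A : Type) (m : regs A) (r : reg) : A :=
  match r with W => atW m | R => atR m | Q => atQ m | K => atK m end.

Definition set (A : Type) (m : regs A) (r : reg) (v : A) : regs A :=
  let: Regs w x y z := m in
  match r with
  | W => Regs v x y z | R => Regs w v y z | Q => Regs w x v z | K => Regs w x y v
  end.

Definition rmap (A B : Type) (f : A -> B) (m : regs A) : regs B :=
  Regs (f (atW m)) (f (atR m)) (f (atQ m)) (f (atK m)).

Definition rmap2 (A B C : Type) (f : A -> B -> C) (m : regs A) (m' : regs B) :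
  regs C :=
  Regs (f (atW m) (atW m')) (f (atR m) (atR m')) (f (atQ m) (atQ m'))
    (f (atK m) (atK m')).

(* Stack symbols: leaf labels, the inner node of a tree ([inr true]) and the
   marker that closes an item on an auxiliary stack ([inr false]). *)
Definition sym : Type := (symbol + bool)%type.
Definition store := regs (seq sym).
Definition view := regs (option sym).

Definition tops (m : store) : view := rmap ohead m.

Inductive prog :=
  | Push of reg & (view -> sym)
  | Pop of reg
  | Seq of prog & prog
  | If of (view -> bool) & prog & prog
  | While of (view -> bool) & prog.

(** The index counts machine steps exactly. A push takes two because a machine writes before it
    moves: one step moves left, the next writes. Each test of a condition takes one. *)
Inductive exec : prog -> store -> nat -> store -> Prop :=
  | ExecPush r f m : exec (Push r f) m 2 (set m r (f (tops m) :: get m r))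
  | ExecPop r m : exec (Pop r) m 1 (set m r (behead (get m r)))
  | ExecSeq p q m1 m2 m3 t u :
      exec p m1 t m2 -> exec q m2 u m3 -> exec (Seq p q) m1 (t + u) m3
  | ExecIf (c : view -> bool) p q m t m' :
      exec (if c (tops m) then p else q) m t m' -> exec (If c p q) m t.+1 m'
  | ExecStop (c : view -> bool) p m : ~~ c (tops m) -> exec (While c p) m 1 m
  | ExecLoop (c : view -> bool) p m1 m2 m3 t u :
      c (tops m1) -> exec p m1 t m2 -> exec (While c p) m2 u m3 ->
      exec (While c p) m1 (t + u).+1 m3.

(** For a push, the control remembers the symbol between its two steps: it is computed from the
    tops, which are no longer all visible once the head has moved onto the blank cell. *)
Fixpoint ctrl (p : prog) : finType :=
  match p with
  | Push _ _ => option sym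
  | Pop _ => unit
  | Seq p q => (ctrl p + ctrl q)%type
  | If _ p q => option (ctrl p + ctrl q)%type
  | While _ p => option (ctrl p)
  end.

Fixpoint entry (p : prog) : ctrl p :=
  match p return ctrl p with
  | Push _ _ => None
  | Pop _ => tt
  | Seq p _ => inl (entry p)
  | If _ _ _ => None
  | While _ _ => None
  end.

Definition action : Type := (option sym * move)%type.

Definition idle (v : view) : regs action := rmap (fun a => (a, Stay)) v.

(* The resulting control [None] means that [p] is finished. *)
Fixpoint next (p : prog) : ctrl p -> view -> option (ctrl p) * regs action :=
  match p return ctrl p -> view -> option (ctrl p) * regs action with
  | Push r f => fun q v =>
      match q with
      | None => (Some (Some (f v)), set (idle v) r (get v r, GoLeft))
      | Some a => (None, set (idle v) r (Some a, Stay))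
      end
  | Pop r => fun _ v => (None, set (idle v) r (None, GoRight))
  | Seq p1 p2 => fun q v =>
      match q with
      | inl q1 => let: (o, a) := next q1 v in
          (Some (if o is Some q' then inl q' else inr (entry p2)), a)
      | inr q2 => let: (o, a) := next q2 v in (omap inr o, a)
      end
  | If c p1 p2 => fun q v =>
      match q with
      | None =>
          (Some (Some (if c v then inl (entry p1) else inr (entry p2))), idle v)
      | Some (inl q1) => let: (o, a) := next q1 v in (omap (Some \o inl) o, a)
      | Some (inr q2) => let: (o, a) := next q2 v in (omap (Some \o inr) o, a)
      end
  | While c p1 => fun q v =>
      match q with
      | None => (if c v then Some (Some (entry p1)) else None, idle v)
      | Some q1 => let: (o, a) := next q1 v in (Some o, a)
      end
  end.

Definition band := tape (option sym).

Definition act (a : action) (t : band) : band :=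
  shift None a.2 (write a.1 t).

Definition apply_next (p : prog) (q : ctrl p) (t : regs band) :
  option (ctrl p) * regs band :=
  let: (o, a) := next q (rmap (@scanned _) t) in (o, rmap2 act a t).

(** The program finishes at step [n] exactly and not before, so that step counts add up under
    sequencing. *)
Fixpoint reaches (p : prog) (n : nat) (q : ctrl p) (t t' : regs band) : Prop :=
  if n is k.+1 then
    let: (o, t1) := apply_next q t in
    if o is Some q' then reaches k q' t1 t' else k = 0 /\ t' = t1
  else False.

(* A stack lies on its tape with its top scanned and its bottom to the right. *)
Definition holds (t : band) (s : seq sym) : Prop :=
  (forall i, nth None (scanned t :: rcells t) i = nth None (map Some s) i) /\
  forall i, nth None (lcells t) i = None.

Definition hold (t : regs band) (m : store) : Prop :=
  forall r, holds (get t r) (get m r).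

Lemma holds_top t s : holds t s -> scanned t = ohead s.
Proof. by case=> /(_ 0) /= -> _; case: s. Qed.

Lemma hold_tops t m : hold t m -> rmap (@scanned _) t = tops m.
Proof.
move=> h; rewrite /rmap /tops /rmap.
by rewrite (holds_top (h W)) (holds_top (h R)) (holds_top (h Q)) (holds_top (h K)).
Qed.

Lemma holds_pop t s : holds t s -> holds (act (None, GoRight) t) (behead s).
Proof.
case: t => l c r [h1 h2]; split=> i /=; last by case: i => /=.
have -> : nth None (map Some (behead s)) i = nth None (map Some s) i.+1.
  by case: s {h1} => //; rewrite nth_nil.
by rewrite -h1 /=; case: r {h1 h2} i => [|x r] [|i] /=; rewrite ?nth_nil.
Qed.

Lemma act_idle t : act (scanned t, Stay) t = t.
Proof. by case: t. Qed.

Lemma holds_push t s a : holds t s ->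
  holds (act (Some a, Stay) (act (scanned t, GoLeft) t)) (a :: s).
Proof.
case: t => l c r [h1 h2]; split=> i; last by rewrite nth_behead; exact: h2.
by case: i => [|i]; [|exact: h1].
Qed.

Lemma get_set (A : Type) (m : regs A) r v : get (set m r v) r = v.
Proof. by case: m r => ? ? ? ? []. Qed.

Lemma rmap2_set (A B C : Type) (f : A -> B -> C) m m' r v :
  rmap2 f (set m r v) m' = set (rmap2 f m m') r (f v (get m' r)).
Proof. by case: m r => ? ? ? ? []; case: m'. Qed.

Lemma set_set (A : Type) (m : regs A) r v v' : set (set m r v) r v' = set m r v'.
Proof. by case: m r => ? ? ? ? []. Qed.

Lemma get_rmap (A B : Type) (f : A -> B) m r : get (rmap f m) r = f (get m r).
Proof. by case: m r => ? ? ? ? []. Qed.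

Lemma idleE t : rmap2 act (idle (rmap (@scanned _) t)) t = t.
Proof. by case: t => a b c d; rewrite /rmap2 /= !act_idle. Qed.

Lemma hold_set t m r b s : hold t m -> holds b s -> hold (set t r b) (set m r s).
Proof.
by case: t m => ? ? ? ? [] ? ? ? ? h hb r'; have := h r'; case: r; case: r'.
Qed.

Lemma reaches_seq2 p1 p2 k q t t2 : reaches k q t t2 ->
  reaches k (inr q : ctrl (Seq p1 p2)) t t2.
Proof.
elim: k q t => [|n IH] q t //=.
by rewrite /apply_next /=; case: (next q _) => -[q'|] a //=; exact: IH.
Qed.

Lemma reaches_seq1 p1 p2 n k q t t1 t2 : reaches n q t t1 ->
  reaches k (entry p2) t1 t2 ->
  reaches (n + k) (inl q : ctrl (Seq p1 p2)) t t2.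
Proof.
move=> h1 h2; elim: n q t h1 => [|n IH] q t //=.
rewrite /apply_next /=; case: (next q _) => -[q'|] a //=; first exact: IH.
by case=> -> <-; exact: reaches_seq2.
Qed.

Lemma reaches_if1 c p1 p2 k q t t2 : reaches k q t t2 ->
  reaches k (Some (inl q) : ctrl (If c p1 p2)) t t2.
Proof.
elim: k q t => [|n IH] q t //=.
by rewrite /apply_next /=; case: (next q _) => -[q'|] a //=; exact: IH.
Qed.

Lemma reaches_if2 c p1 p2 k q t t2 : reaches k q t t2 ->
  reaches k (Some (inr q) : ctrl (If c p1 p2)) t t2.
Proof.
elim: k q t => [|n IH] q t //=.
by rewrite /apply_next /=; case: (next q _) => -[q'|] a //=; exact: IH.
Qed.

Lemma reaches_while c p1 n k q t t1 t2 : reaches n q t t1 ->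
  reaches k (entry (While c p1)) t1 t2 ->
  reaches (n + k) (Some q : ctrl (While c p1)) t t2.
Proof.
move=> h1 h2; elim: n q t h1 => [|n IH] q t //.
rewrite addSn [reaches _.+1 _ _ _]/= /apply_next.
change (reaches (n + k).+1 (Some q : ctrl (While c p1)) t t2) with
  (let: (o, t1) := apply_next (Some q : ctrl (While c p1)) t in
    if o is Some q' then reaches (n + k) q' t1 t2 else n + k = 0 /\ t2 = t1).
rewrite /apply_next /=; case: (next q _) => -[q'|] a //=; first exact: IH.
by case=> -> <-.
Qed.

(** The induction is on the execution rather than on the program, since an iteration of a loop is
    followed by the same loop. *)
Lemma compile_correct p m n m' : exec p m n m' ->
  forall t, hold t m -> exists2 t', reaches n (entry p) t t' & hold t' m'.
Proof.
elim=> {p m n m'} [r f m|r m|p q m1 m2 m3 t u _ IH1 _ IH2|c p q m t m' _ IH|c p m hc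
  |c p m1 m2 m3 t u hc _ IH1 _ IH2] T hT.
- pose v := rmap (@scanned (option sym)) T.
  pose T1 := rmap2 act (set (idle v) r (get v r, GoLeft)) T.
  exists (rmap2 act (set (idle (rmap (@scanned _) T1)) r (Some (f v), Stay)) T1).
    by split.
  rewrite rmap2_set idleE /T1 rmap2_set idleE !get_set set_set get_rmap /v.
  by rewrite (hold_tops hT); apply: hold_set => //; apply: holds_push.
- exists (rmap2 act (set (idle (rmap (@scanned _) T)) r (None, GoRight)) T).
    by split.
  by rewrite rmap2_set idleE; apply: hold_set => //; apply: holds_pop.
- have [T1 h1 hT1] := IH1 _ hT; have [T2 h2 hT2] := IH2 _ hT1.
  by exists T2 => //; exact: reaches_seq1 h1 _.
- have [T1 h1 hT1] := IH _ hT; exists T1 => //=.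
  rewrite /apply_next /= idleE (hold_tops hT).
  by case: (c (tops m)) h1 => ?; [apply: reaches_if1 | apply: reaches_if2].
- exists T => //=; rewrite /apply_next /= idleE (hold_tops hT).
  by rewrite (negbTE hc).
- have [T1 h1 hT1] := IH1 _ hT; have [T2 h2 hT2] := IH2 _ hT1; exists T2 => //.
  rewrite /= /apply_next /= idleE (hold_tops hT) hc.
  exact: reaches_while h1 h2.
Qed.

Definition tabulate (A : Type) (m : regs A) : {ffun 'I_4 -> A} :=
  [ffun i : 'I_4 => match val i with
     | 0 => atW m | 1 => atR m | 2 => atQ m | _ => atK m end].

Definition collect (A : Type) (f : {ffun 'I_4 -> A}) : regs A :=
  Regs (f (inord 0)) (f (inord 1)) (f (inord 2)) (f (inord 3)).

Lemma tabulateK A : cancel (@tabulate A) (@collect A).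
Proof. by case=> w r q k; rewrite /collect !ffunE /= !inordK. Qed.

Lemma tabulate_map A B (f : A -> B) m :
  [ffun i => f (tabulate m i)] = tabulate (rmap f m).
Proof. by apply/ffunP=> i; rewrite !ffunE; case: (val i) => [|[|[|]]]. Qed.

(* The control [inr b] is halting and accepts when [b]; a finished program
   accepts when the leaf on top of [W] is [Bit1]. *)
Definition machine (p : prog) : turing_machine symbol :=
  @TuringMachine symbol 3 bool (option (ctrl p) + bool)%type
    (inl (Some (entry p)))
    (fun q => if q is inr _ then true else false)
    (fun q => if q is inr b then b else false)
    (fun q v =>
       match q with
       | inl (Some q1) =>
           let: (o, a) := next q1 (collect v) in (inl o, tabulate a)
       | inl None =>
           (inr (atW (collect v) == Some (inl Bit1)),
            tabulate (idle (collect v)))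
       | inr b => (inr b, tabulate (idle (collect v)))
       end).

Lemma step_machine p (q : ctrl p) t :
  step (@Config _ (machine p) (inl (Some q)) (tabulate t)) =
  let: (o, t') := apply_next q t in
  @Config _ (machine p) (inl o) (tabulate t').
Proof.
rewrite /step /= /apply_next.
have -> : [ffun i : 'I_4 => scanned (tabulate t i)] = tabulate (rmap (@scanned _) t)
  by exact: tabulate_map.
rewrite tabulateK; case: (next q _) => o a; congr Config.
by apply/ffunP=> i; rewrite !ffunE; case: (val i) => [|[|[|]]].
Qed.

Lemma iter_machine p n (q : ctrl p) t t' : reaches n q t t' ->
  iter n (@step _ (machine p)) (@Config _ (machine p) (inl (Some q)) (tabulate t)) =
  @Config _ (machine p) (inl None) (tabulate t').
Proof.
elim: n q t => [|n IH] q t //; rewrite iterSr step_machine /=.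
case: (apply_next q t) => -[q'|] t1; first exact: IH.
by case=> -> ->.
Qed.

Lemma step_halt p b t n :
  iter n (@step _ (machine p)) (@Config _ (machine p) (inr b) t) =
  @Config _ (machine p) (inr b) t.
Proof. by elim: n => //= n ->. Qed.

(** The strict inequality leaves one step for reading the verdict off [W]. A halted configuration is
    a fixed point of [step], so any larger [N] gives the same answer and a bound on the time is
    enough. *)
Lemma run_machine p (s : seq symbol) n N m' :
  exec p (Regs (map inl s) [::] [::] [::]) n m' -> n < N ->
  let c := run (machine p) N s in
  halting (control c) /\
  accepting (control c) = (ohead (atW m') == Some (inl Bit1)).
Proof.
move=> hp ltnN.
pose t0 := Regs (Tape [::] (head None [seq Some (inl a) | a <- s])
    (behead [seq Some (inl a) | a <- s])) (Tape [::] None [::])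
    (Tape [::] None [::]) (Tape [::] None [::]) : regs band.
have h0 : hold t0 (Regs (map inl s) [::] [::] [::]).
  have nil_holds : holds (Tape [::] None [::]) [::] by split=> -[|i] /=; rewrite ?nth_nil.
  case=> //; split=> i; rewrite ?nth_nil //. 
  by rewrite -map_comp /=; case: s {hp t0} i => [|a s] [|[|i]].
have [t1 hr ht1] := compile_correct hp h0.
have E0 : initial (machine p) s =
    @Config _ (machine p) (inl (Some (entry p))) (tabulate t0).
  rewrite /initial; congr Config; apply/ffunP=> i; rewrite !ffunE.
  by case: i => -[|[|[|[|]]]].
have [t2 E1] : exists t2, step (@Config _ (machine p) (inl None) (tabulate t1)) =
    @Config _ (machine p) (inr (ohead (atW m') == Some (inl Bit1))) t2.
  rewrite /step /=; eexists; congr (@Config _ (machine p) (inr (_ == _)) _).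
  by rewrite tabulate_map ffunE /= inordK //= (holds_top (ht1 W)).
rewrite /run E0 -(subnK ltnN) iterD iterS (iter_machine hr) E1 step_halt.
by split.
Qed.

(** * Programs on stacks of serialised trees *)

(** From here on only upper bounds on the time are tracked, so that costs can be rounded up
    freely. *)
Definition runs (p : prog) (m : store) (n : nat) (m' : store) : Prop :=
  exists2 t, t <= n & exec p m t m'.

Lemma runs_le p m n n' m' : runs p m n m' -> n <= n' -> runs p m n' m'.
Proof. by case=> t le_tn h le_nn'; exists t => //; apply: leq_trans le_nn'. Qed.

Lemma runs_push r f m : runs (Push r f) m 2 (set m r (f (tops m) :: get m r)).
Proof. by exists 2 => //; constructor. Qed.

Lemma runs_pop r m : runs (Pop r) m 1 (set m r (behead (get m r))).
Proof. by exists 1 => //; constructor. Qed.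

Lemma runs_seq p q m1 m2 m3 n1 n2 :
  runs p m1 n1 m2 -> runs q m2 n2 m3 -> runs (Seq p q) m1 (n1 + n2) m3.
Proof.
move=> [t lt ht] [u lu hu]; exists (t + u); first exact: leq_add.
exact: ExecSeq ht hu.
Qed.

Lemma runs_if c p q m n m' : runs (if c (tops m) then p else q) m n m' ->
  runs (If c p q) m n.+1 m'.
Proof. by case=> t lt ht; exists t.+1 => //; constructor. Qed.

Lemma runs_stop (c : view -> bool) p m : ~~ c (tops m) -> runs (While c p) m 1 m.
Proof. by exists 1 => //; constructor. Qed.

Lemma runs_loop (c : view -> bool) p m1 m2 m3 n1 n2 : c (tops m1) -> runs p m1 n1 m2 ->
  runs (While c p) m2 n2 m3 -> runs (While c p) m1 (n1 + n2).+1 m3.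
Proof.
move=> hc [t lt ht] [u lu hu]; exists (t + u).+1; first by rewrite ltnS leq_add.
exact: ExecLoop ht hu.
Qed.

Inductive tree := Leaf of symbol | Node of tree & tree.

Fixpoint ser (t : tree) : seq sym :=
  match t with
  | Leaf a => [:: inl a]
  | Node u v => inr true :: ser u ++ ser v
  end.

Notation marker := (inr false : sym).

Definition unmarked : pred (seq sym) := all (predC1 marker).

Lemma ser_unmarked t : unmarked (ser t).
Proof. by rewrite /unmarked; elim: t => //= u hu v hv; rewrite all_cat hu hv. Qed.

Lemma rev_unmarked t : unmarked (rev (ser t)).
Proof. by rewrite /unmarked all_rev; exact: ser_unmarked. Qed.

(** Polish notation is a prefix code: a tree needs no end mark on a stack. *)
Lemma ser_prefix t u w w' : ser t ++ w = ser u ++ w' -> t = u /\ w = w'.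
Proof.
elim: t u w w' => [a|t1 IH1 t2 IH2] [b|u1 u2] w w' //=; first by case=> -> ->.
by case; rewrite -!catA => /IH1[-> /IH2[-> ->]].
Qed.

Lemma ser_inj : injective ser.
Proof.
move=> t u e; have [] // := @ser_prefix t u [::] [::].
by rewrite !cats0.
Qed.

Lemma size_ser_gt0 t : 0 < size (ser t).
Proof. by case: t. Qed.

Definition put (r : reg) (a : sym) : prog := Push r (fun _ => a).
Definition copy (r r' : reg) : prog := Push r' (fun v => odflt marker (get v r)).

Definition aux (b : bool) : reg := if b then R else Q.

(** The flag exchanges the roles of [R] and [Q], so that each routine on an auxiliary stack is
    verified once for both. *)
Definition layout (b : bool) (w x y k : seq sym) : store :=
  if b then Regs w x y k else Regs w y x k.

Definition nonempty (r : reg) (v : view) : bool := isSome (get v r).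
Definition inside (r : reg) (v : view) : bool := get v r != Some marker.
Definition on_node (v : view) : bool := atW v == Some (inr true).

(* [K] counts the trees that remain to be read: an inner node adds one, a leaf
   removes one. *)
Definition unload (b : bool) : prog :=
  Seq (put (aux b) marker) (Seq (put K marker)
    (While (nonempty K)
      (Seq (copy W (aux b)) (Seq (If on_node (put K marker) (Pop K)) (Pop W))))).

(** Stating the cost of [t] in front of an arbitrary continuation lets the two subtrees of a node be
    read in succession. The factor 7 is the price of one symbol: 1 for the loop test, 2 for the
    copy, at most 3 for the counter, 1 for the pop. *)
Lemma unload_loop b t w x y k n m' :
  runs (While (nonempty K)
    (Seq (copy W (aux b)) (Seq (If on_node (put K marker) (Pop K)) (Pop W))))
    (layout b w (rev (ser t) ++ x) y k) n m' ->
  runs (While (nonempty K)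
    (Seq (copy W (aux b)) (Seq (If on_node (put K marker) (Pop K)) (Pop W))))
    (layout b (ser t ++ w) x y (marker :: k)) (7 * size (ser t) + n) m'.
Proof.
elim: t w x k n => [a|t1 IH1 t2 IH2] w x k n h.
  rewrite /= addSn; apply: runs_loop h; first by case: b.
  apply: (@runs_seq _ _ _ (layout b (inl a :: w) (inl a :: x) y (marker :: k)) _ 2 4).
    by case: b; apply: runs_push.
  apply: (@runs_seq _ _ _ (layout b (inl a :: w) (inl a :: x) y k) _ 3 1).
    by apply: (@runs_if _ _ _ _ 2); apply: (@runs_le _ _ 1) => //;
       case: b; apply: runs_pop.
  by case: b; apply: runs_pop.
apply: (@runs_le _ _ (6 + (7 * size (ser t1) + (7 * size (ser t2) + n))).+1); last first.
  by rewrite /= size_cat; lia.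
apply: (@runs_loop _ _ _
    (layout b (ser t1 ++ ser t2 ++ w) (inr true :: x) y (marker :: marker :: k))).
- by case: b {IH1 IH2 h}.
- apply: (@runs_seq _ _ _ (layout b (ser (Node t1 t2) ++ w) (inr true :: x) y
      (marker :: k)) _ 2 4).
    by case: b {IH1 IH2 h}; apply: runs_push.
  apply: (@runs_seq _ _ _ (layout b (ser (Node t1 t2) ++ w) (inr true :: x) y
      (marker :: marker :: k)) _ 3 1).
    by apply: (@runs_if _ _ _ _ 2); case: b {IH1 IH2 h}; apply: runs_push.
  by rewrite catA; case: b {IH1 IH2 h}; apply: runs_pop.
- apply: IH1; apply: IH2; move: h.
  by rewrite /= rev_cons rev_cat -cats1 -!catA.
Qed.

Lemma unload_spec b t w x y :
  runs (unload b) (layout b (ser t ++ w) x y [::]) (7 * size (ser t) + 5)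
    (layout b w (rev (ser t) ++ marker :: x) y [::]).
Proof.
apply: (@runs_le _ _ (2 + (2 + (7 * size (ser t) + 1)))); last by lia.
apply: (@runs_seq _ _ _ (layout b (ser t ++ w) (marker :: x) y [::])).
  by case: b; apply: runs_push.
apply: (@runs_seq _ _ _ (layout b (ser t ++ w) (marker :: x) y [:: marker])).
  by case: b; apply: runs_push.
by apply: unload_loop; apply: runs_stop; case: b.
Qed.

Definition pour (b : bool) : prog :=
  Seq (While (inside (aux b)) (Seq (copy (aux b) W) (Pop (aux b)))) (Pop (aux b)).

Lemma pour_spec b u w x y : unmarked u ->
  runs (pour b) (layout b w (u ++ marker :: x) y [::]) (4 * size u + 2)
    (layout b (rev u ++ w) x y [::]).
Proof.
move=> hu; apply: (@runs_le _ _ (4 * size u + 1 + 1)); last by lia.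
apply: (@runs_seq _ _ _ (layout b (rev u ++ w) (marker :: x) y [::])); last first.
  by case: b; apply: runs_pop.
elim: u w hu => [|a u IH] w /=; first by move=> _; apply: runs_stop; case: b.
case/andP=> ha /IH{}IH.
apply: (@runs_le _ _ (3 + (4 * size u + 1)).+1); last by lia.
apply: (@runs_loop _ _ _ (layout b (a :: w) (u ++ marker :: x) y [::])).
- by case: b {IH}.
- apply: (@runs_seq _ _ _ (layout b (a :: w) (a :: u ++ marker :: x) y [::]) _ 2 1).
    by case: b {IH}; apply: runs_push.
  by case: b {IH}; apply: runs_pop.
- by rewrite rev_cons -cats1 -catA.
Qed.

Lemma pour_ser b t w x y :
  runs (pour b) (layout b w (rev (ser t) ++ marker :: x) y [::])
    (4 * size (ser t) + 2) (layout b (ser t ++ w) x y [::]).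
Proof.
have := @pour_spec b (rev (ser t)) w x y; rewrite revK size_rev; apply.
exact: rev_unmarked.
Qed.

Definition discard (b : bool) : prog :=
  Seq (While (inside (aux b)) (Pop (aux b))) (Pop (aux b)).

Lemma discard_spec b u w x y : unmarked u ->
  runs (discard b) (layout b w (u ++ marker :: x) y [::]) (2 * size u + 2)
    (layout b w x y [::]).
Proof.
move=> hu; apply: (@runs_le _ _ (2 * size u + 1 + 1)); last by lia.
apply: (@runs_seq _ _ _ (layout b w (marker :: x) y [::])); last first.
  by case: b; apply: runs_pop.
elim: u w hu => [|a u IH] w /=; first by move=> _; apply: runs_stop; case: b.
case/andP=> ha /IH{}IH.
apply: (@runs_le _ _ (1 + (2 * size u + 1)).+1); last by lia.
apply: (@runs_loop _ _ _ (layout b w (u ++ marker :: x) y [::])) => //.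
- by case: b {IH}.
- by case: b {IH}; apply: runs_pop.
Qed.

Definition drop_tree : prog := Seq (unload true) (discard true).

Lemma drop_tree_spec t w r q :
  runs drop_tree (Regs (ser t ++ w) r q [::]) (9 * size (ser t) + 7)
    (Regs w r q [::]).
Proof.
apply: runs_le; first apply: runs_seq (@unload_spec true t w r q) _.
  exact: (@discard_spec true _ w r q (rev_unmarked t)).
by rewrite size_rev; lia.
Qed.

Definition swap : prog :=
  Seq (unload true) (Seq (unload false) (Seq (pour true) (pour false))).

Lemma swap_spec t u w r q :
  runs swap (Regs (ser t ++ ser u ++ w) r q [::])
    (11 * (size (ser t) + size (ser u)) + 14)
    (Regs (ser u ++ ser t ++ w) r q [::]).
Proof.
apply: runs_le; first apply: runs_seq (@unload_spec true t _ r q) _.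
  apply: runs_seq (@unload_spec false u w _ _) _.
  apply: runs_seq (@pour_ser true t w _ _) _.
  exact: (@pour_ser false u _ _ _).
by lia.
Qed.

(* [R] holds the tree reversed, hence copying [R] onto both [W] and [Q] leaves it
   in the wrong order on [Q]; a further reversal through [R] repairs this. *)
Definition dup : prog :=
  Seq (unload true) (Seq (put Q marker)
    (Seq (While (inside R) (Seq (copy R W) (Seq (copy R Q) (Pop R))))
    (Seq (While (inside Q) (Seq (copy Q R) (Pop Q)))
    (Seq (Pop Q) (pour true))))).

Lemma dup_loop1 u w r q : unmarked u ->
  runs (While (inside R) (Seq (copy R W) (Seq (copy R Q) (Pop R))))
    (Regs w (u ++ marker :: r) q [::]) (6 * size u + 1)
    (Regs (rev u ++ w) (marker :: r) (rev u ++ q) [::]).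
Proof.
elim: u w q => [|a u IH] w q /=; first by move=> _; apply: runs_stop.
case/andP=> ha /IH{}IH.
apply: (@runs_le _ _ ((2 + (2 + 1)) + (6 * size u + 1)).+1); last by lia.
apply: runs_loop => //.
  by do 2?[apply: runs_seq; first apply: runs_push]; apply: runs_pop.
by rewrite rev_cons -cats1 -!catA; apply: IH.
Qed.

Lemma dup_loop2 u w r q : unmarked u ->
  runs (While (inside Q) (Seq (copy Q R) (Pop Q)))
    (Regs w r (u ++ marker :: q) [::]) (4 * size u + 1)
    (Regs w (rev u ++ r) (marker :: q) [::]).
Proof.
elim: u r => [|a u IH] r /=; first by move=> _; apply: runs_stop.
case/andP=> ha /IH{}IH.
apply: (@runs_le _ _ ((2 + 1) + (4 * size u + 1)).+1); last by lia.
apply: runs_loop => //.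
  by apply: runs_seq; [apply: runs_push | apply: runs_pop].
by rewrite rev_cons -cats1 -!catA; apply: IH.
Qed.

Lemma dup_spec t w r q :
  runs dup (Regs (ser t ++ w) r q [::]) (21 * size (ser t) + 12)
    (Regs (ser t ++ ser t ++ w) r q [::]).
Proof.
apply: runs_le; first apply: runs_seq (@unload_spec true t _ r q) _.
  apply: runs_seq; first exact: runs_push.
  apply: runs_seq; first exact: (@dup_loop1 _ w r (marker :: q) (rev_unmarked t)).
  rewrite revK; apply: runs_seq; first exact: (dup_loop2 _ _ _ (ser_unmarked t)).
  apply: runs_seq; first exact: runs_pop.
  exact: (@pour_ser true t (ser t ++ w) r q).
by rewrite size_rev; lia.
Qed.

Definition agree (v : view) : bool := (atR v == atQ v) && (atR v != Some marker).
Definition both_done (v : view) : bool :=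
  (atR v == Some marker) && (atQ v == Some marker).

Definition compare : prog :=
  Seq (unload true) (Seq (unload false)
    (Seq (While agree (Seq (Pop R) (Pop Q)))
    (Seq (If both_done (put W (inl Bit1)) (put W (inl Bit0)))
    (Seq (discard true) (discard false))))).

(** The loop stops at the first disagreement or at a marker, and the words are equal exactly when
    both markers are then exposed. The unread remainders are kept existential, with bounds that pay
    for discarding them. *)
Lemma compare_loop u v w r q : unmarked u -> unmarked v ->
  exists u' v', [/\ runs (While agree (Seq (Pop R) (Pop Q)))
    (Regs w (u ++ marker :: r) (v ++ marker :: q) [::]) (3 * size u + 1)
    (Regs w (u' ++ marker :: r) (v' ++ marker :: q) [::]),
    unmarked u' /\ unmarked v', size u' <= size u /\ size v' <= size v &
    both_done (tops (Regs w (u' ++ marker :: r) (v' ++ marker :: q) [::])) =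
    (u == v)].
Proof.
elim: u v => [|a u IH] [|b v] hu hv.
- by exists [::], [::]; split=> //; apply: runs_stop.
- exists [::], (b :: v); split=> //.
    by apply: runs_stop; rewrite /agree /= andbF.
  by case/andP: hv => /= hb _; rewrite /both_done /= (inj_eq (@Some_inj _)) (negbTE hb).
- exists (a :: u), [::]; split=> //.
    case/andP: hu => /= ha _; apply: runs_le; first apply: runs_stop.
      by rewrite /agree /= (inj_eq (@Some_inj _)) (negbTE ha).
    by lia.
  by case/andP: hu => /= ha _; rewrite /both_done /= (inj_eq (@Some_inj _)) (negbTE ha).
case/andP: (hu) (hv) => /= ha hu' /andP[/= hb hv'].
have [eab|nab] := eqVneq a b.
  have [u' [v' [h1 h2 [l1 l2] h3]]] := IH v hu' hv'.
  exists u', v'; split=> //; last by rewrite eqseq_cons eab eqxx.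
    apply: (@runs_le _ _ ((1 + 1) + (3 * size u + 1)).+1); last by lia.
    apply: runs_loop => //.
      by rewrite /agree /= eab eqxx (inj_eq (@Some_inj _)).
    by apply: runs_seq; apply: runs_pop.
    exact: h1.
  by split; [apply: leq_trans l1 _ | apply: leq_trans l2 _]; apply: leqnSn.
exists (a :: u), (b :: v); split=> //.
- apply: runs_le; first apply: runs_stop.
    by rewrite /agree /= (inj_eq (@Some_inj _)) (negbTE nab).
  by lia.
- by rewrite /both_done /= (inj_eq (@Some_inj _)) (negbTE ha) eqseq_cons (negbTE nab).
Qed.

Lemma compare_spec t u w r q :
  runs compare (Regs (ser t ++ ser u ++ w) r q [::])
    (20 * (size (ser t) + size (ser u)) + 20)
    (Regs (inl (encode_bit (ser t == ser u)) :: w) r q [::]).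
Proof.
have [a [b [h1 [ha hb] [la lb] h2]]] := compare_loop w r q (rev_unmarked t) (rev_unmarked u).
apply: runs_le; first apply: runs_seq (@unload_spec true t _ r q) _.
  apply: runs_seq (@unload_spec false u w _ _) _.
  apply: runs_seq h1 _.
  apply: (@runs_seq _ _ _ (Regs (inl (encode_bit (ser t == ser u)) :: w)
    (a ++ marker :: r) (b ++ marker :: q) [::]) _ 3).
    apply: runs_if; rewrite h2 (inj_eq (can_inj revK)).
    by case: eqP => _; apply: runs_push.
  apply: runs_seq; first exact: (@discard_spec true a _ r (b ++ marker :: q) ha).
  exact: (@discard_spec false b _ q r hb).
by rewrite !size_rev in la lb *; lia.
Qed.

(** * Tree codes of data and polynomial bounds in their size *)

Class Code (X : Type) := code : X -> tree.

#[export] Instance code_symbol : Code symbol := Leaf.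
#[export] Instance code_bool : Code bool := fun b => Leaf (encode_bit b).
#[export] Instance code_pair X Y `{Code X} `{Code Y} : Code (X * Y) :=
  fun p => Node (code p.1) (code p.2).
(** The top symbol alone tells an empty list, a leaf, from a nonempty one, an inner node; this is
    the test of [on_node]. *)
#[export] Instance code_seq X `{Code X} : Code (seq X) :=
  foldr (fun x t => Node (code x) t) (Leaf Bit0).

Definition sz X `{Code X} (x : X) : nat := size (ser (code x)).

Lemma sz_gt0 X `{Code X} (x : X) : 0 < sz x.
Proof. exact: size_ser_gt0. Qed.

Lemma sz_symbol (a : symbol) : sz a = 1.
Proof. by []. Qed.

Lemma sz_bool (b : bool) : sz b = 1.
Proof. by []. Qed.

Lemma sz_pair X Y `{Code X} `{Code Y} (p : X * Y) : sz p = (sz p.1 + sz p.2).+1.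
Proof. by rewrite /sz /= size_cat. Qed.

Lemma sz_nil X `{Code X} : sz ([::] : seq X) = 1.
Proof. by []. Qed.

Lemma sz_cons X `{Code X} (x : X) l : sz (x :: l) = (sz x + sz l).+1.
Proof. by rewrite /sz /= size_cat. Qed.

Definition szE := (sz_symbol, sz_bool, sz_pair, sz_nil, sz_cons).

Lemma leq_expr m n e : m <= n -> m ^ e <= n ^ e.
Proof. by case: e => // e le_mn; rewrite leq_exp2r. Qed.

(** A single exponent replaces a polynomial: the base is at least 2, so constants and sums are
    absorbed by raising the exponent. *)
Definition polyb X `{Code X} (f : X -> nat) : Prop :=
  exists d, forall x, f x <= (sz x + 2) ^ d.

Lemma polyb_le X `{Code X} (f g : X -> nat) :
  (forall x, f x <= g x) -> polyb g -> polyb f.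
Proof. by move=> h [d hd]; exists d => x; apply: leq_trans (hd x). Qed.

Lemma polyb_const X `{Code X} n : polyb (fun _ : X => n).
Proof.
exists n => x; apply: leq_trans (ltnW (ltn_expl n (isT : 1 < 2))) _.
by apply: leq_expr; rewrite addn2.
Qed.

Lemma polyb_sz X `{Code X} : polyb (fun x : X => sz x).
Proof. by exists 1 => x; rewrite expn1 leq_addr. Qed.

Lemma polyb_add X `{Code X} (f g : X -> nat) :
  polyb f -> polyb g -> polyb (fun x => f x + g x).
Proof.
move=> [d hd] [e he]; exists (maxn d e).+1 => x.
have h2 : 1 < sz x + 2 by rewrite addn2.
apply: leq_trans (_ : 2 * (sz x + 2) ^ maxn d e <= _).
  rewrite mul2n -addnn leq_add //.
    by apply: leq_trans (hd x) _; rewrite leq_exp2l // leq_maxl.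
  by apply: leq_trans (he x) _; rewrite leq_exp2l // leq_maxr.
by rewrite expnS leq_mul2r h2 orbT.
Qed.

Lemma polyb_mul X `{Code X} (f g : X -> nat) :
  polyb f -> polyb g -> polyb (fun x => f x * g x).
Proof.
by move=> [d hd] [e he]; exists (d + e) => x; rewrite expnD leq_mul.
Qed.

Lemma polyb_exp X `{Code X} (f : X -> nat) d : polyb f -> polyb (fun x => f x ^ d).
Proof.
by move=> [e he]; exists (e * d) => x; rewrite expnM leq_expr.
Qed.

Lemma polyb_comp X Y `{Code X} `{Code Y} (f : X -> Y) (g : Y -> nat) :
  polyb (fun x => sz (f x)) -> polyb g -> polyb (fun x => g (f x)).
Proof.
move=> hf [d hd]; apply: (polyb_le (fun x => hd (f x))).
by apply: polyb_exp; apply: polyb_add => //; apply: polyb_const.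
Qed.

(** * Closure properties of the polynomial-time functions *)

Ltac polyb :=
  lazymatch goal with
  | |- polyb (fun _ => ?n) => exact: polyb_const
  | |- polyb (fun x => addn (@?f x) (@?g x)) => apply: (@polyb_add _ _ f g); polyb
  | |- polyb (fun x => muln (@?f x) (@?g x)) => apply: (@polyb_mul _ _ f g); polyb
  | |- polyb (fun x => expn (@?f x) ?d) => apply: (@polyb_exp _ _ f d); polyb
  | |- polyb (fun x => sz x) => exact: polyb_sz
  | |- polyb (@sz _ _) => exact: polyb_sz
  | |- _ => try assumption
  end.

(** A frame condition: whatever lies below the argument and on [R] and [Q] is preserved, so programs
    can be nested. [K] is empty at both ends because [unload] stops when it becomes empty. *)
Definition computes X Y `{Code X} `{Code Y} (p : prog) (T : X -> nat) (f : X -> Y) :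
  Prop :=
  forall x w r q, runs p (Regs (ser (code x) ++ w) r q [::]) (T x)
    (Regs (ser (code (f x)) ++ w) r q [::]).

(** The size of the value is bounded along with the time, so that in a composition the time of the
    second program is bounded in the original argument. *)
Definition PT X Y `{Code X} `{Code Y} (f : X -> Y) : Prop :=
  exists p T, [/\ polyb T, polyb (fun x => sz (f x)) & computes p T f].

Lemma pt_polyb X Y `{Code X} `{Code Y} (f : X -> Y) :
  PT f -> polyb (fun x => sz (f x)).
Proof. by case=> p [T []]. Qed.

Lemma eq_pt X Y `{Code X} `{Code Y} (f g : X -> Y) : f =1 g -> PT f -> PT g.
Proof.
move=> efg [p [T [hT hs hp]]]; exists p, T; split=> //.
  by apply: polyb_le hs => x; rewrite efg.
by move=> x w r q; rewrite -efg; apply: hp.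
Qed.

Lemma pt_comp X Y Z `{Code X} `{Code Y} `{Code Z} (g : Y -> Z) (f : X -> Y) :
  PT g -> PT f -> PT (fun x => g (f x)).
Proof.
move=> [p [T [hT hs hp]]] [p' [T' [hT' hs' hp']]].
exists (Seq p' p), (fun x => T' x + T (f x)); split.
- exact: polyb_add hT' (polyb_comp hs' hT).
- exact: polyb_comp hs' hs.
- by move=> x w r q; apply: runs_seq; [apply: hp' | apply: hp].
Qed.

Definition skip : prog := If xpredT (Seq (put R marker) (Pop R)) (Pop R).

Lemma skip_spec m : runs skip m 4 m.
Proof.
apply: runs_if; apply: (@runs_seq _ _ _ (set m R (marker :: get m R)) _ 2 1).
  exact: runs_push.
by have := @runs_pop R (set m R (marker :: get m R)); case: m.
Qed.

Lemma pt_recode X Y `{Code X} `{Code Y} (f : X -> Y) :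
  (forall x, code (f x) = code x) -> PT f.
Proof.
move=> e; exists skip, (fun=> 4); split; first exact: polyb_const.
  by apply: polyb_le (@polyb_sz _ _) => x; rewrite /sz e.
by move=> x w r q; rewrite e; apply: skip_spec.
Qed.

Lemma pt_id X `{Code X} : PT (fun x : X => x).
Proof. exact: pt_recode. Qed.

Lemma pt_const X Y `{Code X} `{Code Y} (c : Y) : PT (fun _ : X => c).
Proof.
pose write_out := foldr (fun a p => Seq p (put W a)) skip.
exists (Seq drop_tree (write_out (ser (code c)))),
  (fun x => (9 * sz x + 7) + (2 * sz c + 4)); split.
- polyb.
- exact: polyb_const.
move=> x w r q; apply: runs_seq; first exact: drop_tree_spec.
rewrite /sz; elim: (ser (code c)) => [|a u IH] /=; first exact: skip_spec.
apply: (@runs_le _ _ (2 * size u + 4 + 2)); last by lia.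
by apply: runs_seq; [apply: IH | apply: runs_push].
Qed.

Lemma pt_pair X Y Z `{Code X} `{Code Y} `{Code Z} (f : X -> Y) (g : X -> Z) :
  PT f -> PT g -> PT (fun x => (f x, g x)).
Proof.
move=> [p [T [hT hs hp]]] [p' [T' [hT' hs' hp']]].
exists (Seq dup (Seq p' (Seq swap (Seq p (put W (inr true)))))).
exists (fun x => (21 * sz x + 12) + (T' x + ((11 * (sz (g x) + sz x) + 14) + (T x + 2)))).
split.
- polyb.
- apply: (@polyb_le _ _ _ (fun x => sz (f x) + sz (g x) + 1)).
    by move=> x; rewrite szE /= addn1.
  by do !apply: polyb_add => //; exact: polyb_const.
move=> x w r q; apply: runs_seq; first exact: dup_spec.
apply: runs_seq; first exact: hp'.
apply: runs_seq; first exact: swap_spec.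
apply: runs_seq; first exact: hp.
by rewrite /= -catA; apply: runs_push.
Qed.

Lemma pt_fst X Y `{Code X} `{Code Y} : PT (fun p : X * Y => p.1).
Proof.
exists (Seq (Pop W) (Seq swap drop_tree)), (fun p => 1 + (11 * sz p + 14 + (9 * sz p + 7))).
split.
- polyb.
- by apply: polyb_le (@polyb_sz _ _) => p; rewrite szE; lia.
move=> [x y] w r q; apply: runs_seq; first exact: runs_pop.
rewrite /= -catA; apply: runs_seq.
  by apply: runs_le; [exact: swap_spec | rewrite szE /sz /=; lia].
by apply: runs_le; [exact: drop_tree_spec | rewrite szE /sz /=; lia].
Qed.

Lemma pt_snd X Y `{Code X} `{Code Y} : PT (fun p : X * Y => p.2).
Proof.
exists (Seq (Pop W) drop_tree), (fun p => 1 + (9 * sz p + 7)).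
split.
- polyb.
- by apply: polyb_le (@polyb_sz _ _) => p; rewrite szE; lia.
move=> [x y] w r q; apply: runs_seq; first exact: runs_pop.
rewrite /= -catA.
by apply: runs_le; [exact: drop_tree_spec | rewrite szE /sz /=; lia].
Qed.

Lemma pt_if X Y `{Code X} `{Code Y} (c : X -> bool) (f g : X -> Y) :
  PT c -> PT f -> PT g -> PT (fun x => if c x then f x else g x).
Proof.
move=> [pc [Tc [hTc _ hpc]]] [p [T [hT hs hp]]] [p' [T' [hT' hs' hp']]].
exists (Seq dup (Seq pc (If (fun v => atW v == Some (inl Bit1))
  (Seq (Pop W) p) (Seq (Pop W) p')))).
exists (fun x => (21 * sz x + 12) + (Tc x + (1 + T x + T' x + 1))); split.
- polyb.
- apply: (@polyb_le _ _ _ (fun x => sz (f x) + sz (g x))).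
    by move=> x; case: (c x); lia.
  exact: polyb_add.
move=> x w r q; apply: runs_seq; first exact: dup_spec.
apply: runs_seq; first exact: hpc.
rewrite -[1 + T x + _ + 1]addnC add1n; apply: runs_if.
have -> : (atW (tops (Regs (ser (code (c x)) ++ ser (code x) ++ w) r q [::])) ==
    Some (inl Bit1)) = c x by case: (c x); [exact: eqxx | exact/eqP].
case: (c x).
  apply: (@runs_le _ _ (1 + T x)); last by lia.
  by apply: runs_seq; [apply: runs_pop | apply: hp].
apply: (@runs_le _ _ (1 + T' x)); last by lia.
by apply: runs_seq; [apply: runs_pop | apply: hp'].
Qed.

Lemma pt_eq_pair (X : eqType) `{Code X} : injective (@code X _) ->
  PT (fun p : X * X => p.1 == p.2).
Proof.
move=> inj.
exists (Seq (Pop W) compare), (fun p => 1 + (20 * sz p + 20)); split.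
- polyb.
- by apply: polyb_le (@polyb_const _ _ 1) => p.
move=> [x y] w r q; apply: runs_seq; first exact: runs_pop.
have -> : (x == y) = (ser (code x) == ser (code y)).
  by apply/eqP/eqP => [->|/ser_inj/inj].
rewrite /= -catA.
by apply: runs_le; [exact: compare_spec | rewrite szE /sz /=; lia].
Qed.

Lemma pt_eq (X : eqType) Y `{Code Y} `{Code X} (f g : Y -> X) :
  injective (@code X _) -> PT f -> PT g -> PT (fun y => f y == g y).
Proof.
by move=> inj hf hg; exact: (pt_comp (pt_eq_pair inj) (pt_pair hf hg)).
Qed.

Lemma pt_symbol (h : symbol -> bool) : PT h.
Proof.
exists (Seq (Push R (fun v =>
    inl (encode_bit (if atW v is Some (inl a) then h a else false))))
  (Seq (Pop W) (Seq (copy R W) (Pop R)))), (fun=> 2 + (1 + (2 + 1))); split.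
- polyb.
- exact: polyb_const.
move=> a w r q; apply: runs_seq; first exact: runs_push.
apply: runs_seq; first exact: runs_pop.
by apply: runs_seq; [exact: runs_push | exact: runs_pop].
Qed.

Lemma ser_cons X `{Code X} (x : X) l :
  ser (code (x :: l)) = inr true :: ser (code x) ++ ser (code l).
Proof. by []. Qed.

Lemma on_node_seq X `{Code X} (l : seq X) w r q :
  on_node (tops (Regs (ser (code l) ++ w) r q [::])) = ~~ nilp l.
Proof. by case: l. Qed.

Lemma pt_nilp X `{Code X} : PT (fun l : seq X => nilp l).
Proof.
exists (If on_node (Seq drop_tree (put W (inl Bit0))) (Seq drop_tree (put W (inl Bit1)))),
  (fun l => 1 + (9 * sz l + 7 + 2)); split.
- polyb.
- exact: polyb_const.
move=> l w r q; apply: runs_if; rewrite on_node_seq.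
by case: l => [|x l]; (apply: runs_seq; [exact: drop_tree_spec | exact: runs_push]).
Qed.

Lemma pt_behead X `{Code X} : PT (fun l : seq X => behead l).
Proof.
exists (If on_node (Seq (Pop W) drop_tree) skip), (fun l => 1 + (1 + (9 * sz l + 7))).
split.
- polyb.
- by apply: polyb_le (@polyb_sz _ _) => -[|x l] //=; rewrite szE; lia.
move=> l w r q; apply: runs_if; rewrite on_node_seq; case: l => [|x l].
  by apply: runs_le; [exact: skip_spec | lia].
apply: runs_le; first apply: runs_seq.
- exact: runs_pop.
- by rewrite /= -catA; exact: drop_tree_spec.
- by rewrite szE /sz /=; lia.
Qed.

Lemma pt_head X `{Code X} (x0 : X) : PT (fun l : seq X => head x0 l).
Proof.
have [p [T [hT hs hp]]] := @pt_const (seq X) X _ _ x0.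
exists (If on_node (Seq (Pop W) (Seq swap drop_tree)) p),
  (fun l => 1 + (1 + (11 * sz l + 14 + (9 * sz l + 7)) + T l)).
split.
- polyb.
- apply: (@polyb_le _ _ _ (fun l => sz l + sz x0)); last by polyb.
  by move=> [|x l] //=; rewrite !szE; lia.
move=> l w r q; apply: runs_if; rewrite on_node_seq; case: l => [|x l].
  by apply: runs_le; [exact: hp | lia].
apply: runs_le; first apply: runs_seq.
- exact: runs_pop.
- by rewrite ser_cons /= -catA; apply: runs_seq; [exact: swap_spec | exact: drop_tree_spec].
- by rewrite szE /sz; lia.
Qed.

(** The accumulator lies beneath the list. In each round the element and the tail are lifted off,
    the element is put back and paired with the accumulator, and the tail waits on [Q] while [p]
    runs. *)
Definition fold_prog (p : prog) : prog :=
  Seq (While on_node (Seq (Pop W) (Seq (unload true) (Seq (unload false)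
    (Seq (pour true) (Seq (put W (inr true)) (Seq p (pour false))))))))
  (Pop W).

(** [N] bounds the time of [p] on every accumulator that occurs, and [M] the size of the list. The
    factor 11 is 7 for unloading a symbol plus 4 for pouring it back. *)
Lemma fold_spec Y S `{Code Y} `{Code S} p T (f : Y * S -> S) (l : seq Y) (s : S) N M w r q :
  computes p T f -> sz l <= M ->
  (forall l1 y l2, l = l1 ++ y :: l2 ->
     T (y, foldl (fun s y => f (y, s)) s l1) <= N) ->
  runs (fold_prog p) (Regs (ser (code l) ++ ser (code s) ++ w) r q [::])
    (size l * (N + 11 * M + 20) + 2)
    (Regs (ser (code (foldl (fun s y => f (y, s)) s l)) ++ w) r q [::]).
Proof.
move=> hp hM hN; apply: (@runs_le _ _ (size l * (N + 11 * M + 20) + 1 + 1)); last by lia.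
apply: (@runs_seq _ _ _ (Regs (inl Bit0 ::
    ser (code (foldl (fun s y => f (y, s)) s l)) ++ w) r q [::])); last exact: runs_pop.
elim: l s hM hN => [|y l IH] s hM hN /=; first exact: runs_stop.
have {}hM : sz y + sz l < M by rewrite szE in hM.
have {}IH := IH (f (y, s)) _ _.
apply: (@runs_le _ _ ((1 + (7 * sz y + 5 + (7 * sz l + 5 + (4 * sz y + 2 +
  (2 + (N + (4 * sz l + 2))))))) + (size l * (N + 11 * M + 20) + 1)).+1); last by lia.
apply: runs_loop => //; last first.
  apply: IH; first by apply: leq_trans hM; lia.
  by move=> l1 y' l2 e; apply: (hN (y :: l1) y' l2); rewrite e.
apply: runs_seq; first exact: runs_pop.
rewrite /= -catA; apply: runs_seq; first exact: (@unload_spec true (code y) _ r q).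
apply: runs_seq; first exact: (@unload_spec false (code l) _ q _).
apply: runs_seq; first exact: (@pour_ser true (code y) _ r _).
apply: runs_seq; first exact: runs_push.
apply: runs_seq; last exact: (@pour_ser false (code l) _ q r).
have := runs_le (hp (y, s) w r (rev (ser (code l)) ++ marker :: q)) (hN [::] y l erefl).
by rewrite /= -catA.
Qed.

Lemma size_le_sz X `{Code X} (l : seq X) : size l <= sz l.
Proof. by elim: l => //= x l IH; rewrite szE; lia. Qed.

Lemma sz_cat X `{Code X} (l l' : seq X) : (sz (l ++ l')).+1 = sz l + sz l'.
Proof. by elim: l => [|x l IH] //=; rewrite ?szE; lia. Qed.

(** The bound is required of every prefix of the list, since the running time depends on all
    intermediate accumulators. [fold_prog] hands to its body only an element and the accumulator, so
    the environment travels inside the accumulator. *)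
Lemma pt_foldl_bounded E S Y `{Code E} `{Code S} `{Code Y}
    (f : E -> S -> Y -> S) (init : E -> S) (l : E -> seq Y) (B : E -> nat) :
  PT (fun p : (E * S) * Y => f p.1.1 p.1.2 p.2) -> PT init -> PT l -> polyb B ->
  (forall e l1 l2, l e = l1 ++ l2 -> sz (foldl (f e) (init e) l1) <= B e) ->
  PT (fun e => foldl (f e) (init e) (l e)).
Proof.
move=> hf hi hl hB hb.
have [p0 [T0 [hT0 _ hp0]]] := pt_pair hl (pt_pair (@pt_id E _) hi).
pose F (x : Y * (E * S)) := (x.2.1, f x.2.1 x.2.2 x.1).
have hF : PT F.
  pose proof (@pt_snd Y (E * S) _ _) as h2.
  pose proof (@pt_fst Y (E * S) _ _) as h1.
  pose proof (pt_comp (@pt_fst E S _ _) h2) as h21.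
  pose proof (pt_comp (@pt_snd E S _ _) h2) as h22.
  exact: pt_pair h21 (pt_comp hf (pt_pair (pt_pair h21 h22) h1)).
have [p [T [[d hT] _ hp]]] := hF.
have [ps [Ts [hTs _ hps]]] := @pt_snd E S _ _.
(* The 4 accounts for the two pair nodes of [(y, (e, s))] and the 2 in the base of [polyb]. *)
pose (N := fun e : E => (sz e + B e + sz (l e) + 4) ^ d).
have foldF e l1 s : foldl (fun s y => F (y, s)) (e, s) l1 = (e, foldl (f e) s l1).
  by elim: l1 s => //= y l1 IH s; rewrite IH.
exists (Seq p0 (Seq (Pop W) (Seq (fold_prog p) ps))), (fun e => T0 e + (1 +
  ((sz (l e) * (N e + 11 * sz (l e) + 20) + 2) + Ts (e, foldl (f e) (init e) (l e))))).
have hszl := pt_polyb hl.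
have hout : polyb (fun e => sz (foldl (f e) (init e) (l e))).
  by apply: polyb_le hB => e; apply: (hb e _ [::]); rewrite cats0.
split=> //.
- rewrite /N; polyb; apply: (@polyb_comp _ _ _ _ (fun e => (e, _)) Ts) => //.
  apply: (@polyb_le _ _ _ (fun e => sz e + sz (foldl (f e) (init e) (l e)) + 1)).
    by move=> e; rewrite szE /=; lia.
  by polyb.
move=> e w r q; apply: runs_seq; first exact: hp0.
apply: runs_seq; first exact: runs_pop.
rewrite /= -!catA; apply: (@runs_seq _ _ _ (Regs (ser (code
    (e, foldl (f e) (init e) (l e))) ++ w) r q [::])); last exact: hps.
rewrite -foldF; apply: (@runs_le _ _ (size (l e) * (N e + 11 * sz (l e) + 20) + 2)).
  have := @fold_spec _ _ _ _ p T F (l e) (e, init e) (N e) _ w r q hp (leqnn _).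
  rewrite {2}/code /= -catA; apply=> l1 y l2 el; rewrite foldF.
  apply: leq_trans (hT _) _; rewrite !szE /N /=; apply: leq_expr.
  pose proof (sz_cat l1 (y :: l2)) as h1; rewrite -el szE in h1.
  by pose proof (sz_gt0 l1); have := hb _ _ _ el; lia.
by rewrite leq_add2r leq_mul2r size_le_sz orbT.
Qed.

(** Increments that do not depend on the accumulator sum to at most the length of the list times
    their largest value [M], which bounds every prefix. *)
Lemma pt_foldl E S Y `{Code E} `{Code S} `{Code Y}
    (f : E -> S -> Y -> S) (init : E -> S) (l : E -> seq Y) (B : E * Y -> nat) :
  polyb B -> (forall e s y, sz (f e s y) <= sz s + B (e, y)) ->
  PT (fun p : (E * S) * Y => f p.1.1 p.1.2 p.2) -> PT init -> PT l ->
  PT (fun e => foldl (f e) (init e) (l e)).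
Proof.
move=> [d hd] hB hf hi hl.
have h1 := pt_polyb hi; have h2 := pt_polyb hl.
pose (M := fun e : E => (sz e + sz (l e) + 3) ^ d).
apply: (@pt_foldl_bounded _ _ _ _ _ _ f init l
  (fun e => sz (init e) + sz (l e) * M e)) => //.
  by rewrite /M; polyb.
move=> e l1 l2 el; apply: (@leq_trans (sz (init e) + size l1 * M e)); last first.
  rewrite leq_add2l leq_mul2r; apply/orP; right.
  by rewrite (leq_trans _ (size_le_sz (l e))) // el size_cat leq_addr.
elim/last_ind: l1 l2 el => [|l1 y IH] l2 el; first exact: leq_addr.
rewrite foldl_rcons size_rcons mulSn; rewrite cat_rcons in el.
have le_BM : B (e, y) <= M e.
  apply: leq_trans (hd _) _; apply: leq_expr; rewrite szE /=.
  pose proof (sz_cat l1 (y :: l2)) as h3; rewrite -el szE in h3.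
  by pose proof (sz_gt0 l1); lia.
by apply: leq_trans (hB _ _ _) _; have := IH _ el; lia.
Qed.

(** * From raw input strings to membership in P *)

Definition load : prog :=
  Seq (While (nonempty W) (Seq (copy W R) (Pop W)))
  (Seq (put W (inl Bit0))
    (While (nonempty R) (Seq (copy R W) (Seq (put W (inr true)) (Pop R))))).

Lemma load_loop (t u : seq symbol) : runs
    (While (nonempty R) (Seq (copy R W) (Seq (put W (inr true)) (Pop R))))
    (Regs (ser (code u)) (map inl t) [::] [::]) (6 * size t + 1)
    (Regs (ser (code (catrev t u))) [::] [::] [::]).
Proof.
elim: t u => [|a t IH] u /=; first exact: runs_stop.
apply: (@runs_le _ _ ((2 + (2 + 1)) + (6 * size t + 1)).+1); last by lia.
apply: runs_loop => //.
apply: runs_seq; first exact: runs_push.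
by apply: runs_seq; [exact: runs_push | exact: runs_pop].
Qed.

Lemma load_spec (s : seq symbol) :
  runs load (Regs (map inl s) [::] [::] [::]) (10 * size s + 4)
    (Regs (ser (code s)) [::] [::] [::]).
Proof.
have h1 r : runs (While (nonempty W) (Seq (copy W R) (Pop W)))
    (Regs (map inl s) r [::] [::]) (4 * size s + 1)
    (Regs [::] (rev (map inl s) ++ r) [::] [::]).
  elim: s r => [|a s IH] r /=; first exact: runs_stop.
  apply: (@runs_le _ _ ((2 + 1) + (4 * size s + 1)).+1); last by lia.
  apply: runs_loop => //.
    by apply: runs_seq; [exact: runs_push | exact: runs_pop].
  by rewrite rev_cons -cats1 -catA; apply: IH.
apply: runs_le; first apply: runs_seq (h1 [::]) _.
  apply: runs_seq; first exact: runs_push.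
  pose proof (load_loop (rev s) [::]) as h2.
  by rewrite catrevE revK !cats0 map_rev in h2; rewrite cats0; exact: h2.
by rewrite size_rev; lia.
Qed.

Theorem pt_in_P (L : seq symbol -> Prop) (f : seq symbol -> bool) :
  PT f -> (forall s, f s <-> L s) -> in_P L.
Proof.
move=> [p [T [[d hT] _ hp]]] hL.
(* A string of length [X] has a code of size [2X + 1], whence the base [2X + 3]. Loading takes
   [10X + 4], and one more unit makes the inequality of [run_machine] strict. *)
pose P : {poly nat} := (10%:P * 'X + 5%:P + (2%:P * 'X + 3%:P) ^+ d)%R.
exists (machine (Seq load p)), P => s c.
have szs : sz s = 2 * size s + 1.
  by elim: s {c} => // a s IH; rewrite !szE IH /=; lia.
have [n lt_n] : runs (Seq load p) (Regs (map inl s) [::] [::] [::])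
    (10 * size s + 4 + T s) (Regs (ser (code (f s))) [::] [::] [::]).
  by apply: runs_seq (load_spec s) _; have := hp s [::] [::] [::]; rewrite !cats0.
have hP : n < (P.[size s])%R.
  rewrite /P !hornerD horner_exp hornerD !hornerCM !hornerX !hornerC.
  rewrite !natrDE !natrME !natrXE.
  have := hT s; rewrite szs -addnA => le_T.
  apply: leq_ltn_trans lt_n _; apply: (@leq_ltn_trans (10 * size s + 4 + (2 * size s + 3) ^ d)).
    by rewrite leq_add2l; exact: le_T.
  by rewrite ltn_add2r ltn_add2l.
move=> /run_machine /(_ hP) []; rewrite -/c => hh ha; split=> //.
rewrite ha -hL; case: (f s) => /=.
  by split=> // _; exact: eqxx.
by split=> // /eqP.
Qed.

(** * Automation and closure rules for lists *)

Ltac is_if X f :=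
  let _ := constr:(fun x : X => ltac:(
    let y := eval cbv beta in (f x) in
    lazymatch y with (if _ then _ else _) => exact y end)) in idtac.
Ltac pt_user := fail.
Ltac pt :=
  cbv beta;
  lazymatch goal with
  | |- PT (fun x => x) => apply pt_id
  | |- PT fst => apply pt_fst
  | |- PT snd => apply pt_snd
  | |- PT (fun _ => ?c) => apply pt_const
  | |- PT (fun x => (@?a x, @?b x)) => apply (@pt_pair _ _ _ _ _ _ a b); pt
  | |- PT (fun x => fst (@?a x)) => apply (@pt_comp _ _ _ _ _ _ fst a); [apply pt_fst | pt]
  | |- PT (fun x => snd (@?a x)) => apply (@pt_comp _ _ _ _ _ _ snd a); [apply pt_snd | pt]
  | |- PT (fun x => behead (@?a x)) => apply (@pt_comp _ _ _ _ _ _ (fun l => behead l) a); [apply pt_behead | pt]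
  | |- PT (fun x => head ?d (@?a x)) => apply (@pt_comp _ _ _ _ _ _ (fun l => head d l) a); [apply pt_head | pt]
  | |- PT (fun x => nilp (@?a x)) => apply (@pt_comp _ _ _ _ _ _ (fun l => nilp l) a); [apply pt_nilp | pt]
  | h : PT ?f |- PT (fun x => ?f (@?a x)) => apply (@pt_comp _ _ _ _ _ _ f a h); pt
  | h : PT (fun y => ?f (fst y) (snd y)) |- PT (fun x => ?f (@?a x) (@?b x)) =>
      apply (@pt_comp _ _ _ _ _ _ (fun y => f (fst y) (snd y)) (fun x => (a x, b x)) h); pt
  | |- @PT ?X _ _ _ ?f => first [assumption | pt_user | is_if X f; apply pt_if]; pt
  | |- _ => idtac
  end.

Section ListRules.

Context (E S Y Z : Type) {HE : Code E} {HS : Code S} {HY : Code Y} {HZ : Code Z}.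

Lemma pt_cons (a : E -> Y) (l : E -> seq Y) : PT a -> PT l -> PT (fun e => a e :: l e).
Proof.
move=> ha hl.
have hc : PT (fun p : Y * seq Y => p.1 :: p.2) by apply: pt_recode.
exact: (pt_comp hc (pt_pair ha hl)).
Qed.

Lemma pt_rev (l : E -> seq Y) : PT l -> PT (fun e => rev (l e)).
Proof.
move=> hl; apply: (@eq_pt _ _ _ _ (fun e => foldl (fun s y => y :: s) [::] (l e))).
  by move=> e; elim/last_ind: (l e) => // s y IH; rewrite foldl_rcons rev_rcons IH.
apply: (@pt_foldl E (seq Y) Y _ _ _ (fun e s y => y :: s) (fun=> [::]) l
   (fun p => sz p.2 + 1)) => //; last exact: pt_const.
- by apply: (@polyb_le _ _ _ (fun p => sz p + 1)); [move=> p; rewrite szE; lia | polyb].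
- by move=> e s y /=; rewrite !szE; lia.
- have h1 : PT (fun p : E * seq Y * Y => p.1.2) by pt.
  have h2 : PT (fun p : E * seq Y * Y => p.2) by pt.
  apply: (@pt_comp _ _ _ _ _ _ (fun p : Y * seq Y => p.1 :: p.2) (fun p : E * seq Y * Y => (p.2, p.1.2))).
    exact: pt_recode.
  exact: pt_pair.
Qed.

Lemma pt_foldr (f : E -> Y -> S -> S) (init : E -> S) (l : E -> seq Y) (B : E * Y -> nat) :
  polyb B -> (forall e y s, sz (f e y s) <= sz s + B (e, y)) ->
  PT (fun p : (E * Y) * S => f p.1.1 p.1.2 p.2) -> PT init -> PT l ->
  PT (fun e => foldr (f e) (init e) (l e)).
Proof.
move=> hB hb hf hi hl.
apply: (@eq_pt _ _ _ _ (fun e => foldl (fun s y => f e y s) (init e) (rev (l e)))).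
  by move=> e; rewrite foldl_rev.
apply: (@pt_foldl _ _ _ _ _ _ (fun e s y => f e y s) init _ B) => //; last exact: pt_rev.
apply: (@pt_comp _ _ _ _ _ _ (fun p : (E * Y) * S => f p.1.1 p.1.2 p.2)
  (fun p : E * S * Y => ((p.1.1, p.2), p.1.2))) => //.
by pt.
Qed.

End ListRules.

Lemma code_symbol_inj : injective (@code symbol _).
Proof. by move=> a b []. Qed.

Lemma code_bool_inj : injective (@code bool _).
Proof. by do 2!case. Qed.

Lemma code_pair_inj X Y `{Code X} `{Code Y} : injective (@code X _) ->
  injective (@code Y _) -> injective (@code (X * Y) _).
Proof. by move=> hX hY [a b] [c d] [/hX -> /hY ->]. Qed.

Lemma code_seq_inj X `{Code X} : injective (@code X _) -> injective (@code (seq X) _).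
Proof. by move=> hX; elim=> [|a s IH] [|b t] //= [/hX -> /IH ->]. Qed.

Ltac code_inj := first [ exact code_symbol_inj | exact code_bool_inj
  | apply code_pair_inj; code_inj | apply code_seq_inj; code_inj | assumption ].

Ltac pt2 f lem a b :=
  apply (@pt_comp _ _ _ _ _ _ (fun p => f (fst p) (snd p)) (fun x => (a x, b x)) lem).
Ltac pt1 f lem a := apply (@pt_comp _ _ _ _ _ _ (fun p => f p) a lem).

Lemma pt_addb E `{Code E} (a b : E -> bool) : PT a -> PT b -> PT (fun e => a e (+) b e).
Proof.
move=> ha hb.
apply: (@eq_pt _ _ _ _ (fun e => if a e then (if b e then false else true) else b e)).
  by move=> e; case: (a e); case: (b e).
by pt.
Qed.

Ltac pt_basic :=
  lazymatch goal with
  | |- PT (fun x => andb (@?a x) (@?b x)) => apply (@pt_if _ _ _ _ a b (fun=> false))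
  | |- PT (fun x => orb (@?a x) (@?b x)) => apply (@pt_if _ _ _ _ a (fun=> true) b)
  | |- PT (fun x => implb (@?a x) (@?b x)) => apply (@pt_if _ _ _ _ a b (fun=> true))
  | |- PT (fun x => negb (@?a x)) => apply (@pt_if _ _ _ _ a (fun=> false) (fun=> true))
  | |- PT (fun x => addb (@?a x) (@?b x)) => apply (@pt_addb _ _ a b)
  | |- PT (fun x => cons (@?a x) (@?b x)) => apply (@pt_cons _ _ _ _ a b)
  | |- PT (fun x => rev (@?a x)) => apply (@pt_rev _ _ _ _ a)
  | |- PT (fun x => eq_op (@?a x) (@?b x)) => apply (@pt_eq _ _ _ _ a b); [code_inj | | ]
  end.

Ltac pt_user ::= pt_basic.

Section MoreListRules.

Context (E S Y Z : Type) {HE : Code E} {HS : Code S} {HY : Code Y} {HZ : Code Z}.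

Lemma pt_cat (a b : E -> seq Y) : PT a -> PT b -> PT (fun e => a e ++ b e).
Proof.
move=> ha hb; apply: (@eq_pt _ _ _ _ (fun e => foldr cons (b e) (a e))).
  by move=> e; elim: (a e) => //= y s ->.
apply: (@pt_foldr E (seq Y) Y _ _ _ (fun _ => cons) b a (fun p => sz p.2 + 1)) => //.
- by apply: (@polyb_le _ _ _ (fun p => sz p + 1)); [move=> p; rewrite szE; lia | polyb].
- by move=> e y s /=; rewrite szE; lia.
- by pt.
Qed.

Lemma pt_map (f : E -> Y -> Z) (l : E -> seq Y) :
  PT (fun p : E * Y => f p.1 p.2) -> PT l -> PT (fun e => map (f e) (l e)).
Proof.
move=> hf hl; pose proof (pt_polyb hf) as hs.
apply: (@eq_pt _ _ _ _ (fun e => foldr (fun y s => f e y :: s) [::] (l e))) => //.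
apply: (@pt_foldr E (seq Z) Y _ _ _ (fun e y s => f e y :: s) (fun=> [::]) l
   (fun p => sz (f p.1 p.2) + 1)) => //.
- by polyb.
- by move=> e y s /=; rewrite szE; lia.
- have h : PT (fun p : E * Y * seq Z => f p.1.1 p.1.2).
    by apply: (@pt_comp _ _ _ _ _ _ (fun p : E * Y => f p.1 p.2)
      (fun p : E * Y * seq Z => p.1)) => //; pt.
  by pt.
- exact: pt_const.
Qed.

Lemma pt_filter (f : E -> Y -> bool) (l : E -> seq Y) :
  PT (fun p : E * Y => f p.1 p.2) -> PT l -> PT (fun e => filter (f e) (l e)).
Proof.
move=> hf hl.
apply: (@eq_pt _ _ _ _ (fun e => foldr (fun y s => if f e y then y :: s else s)
  [::] (l e))) => //.
apply: (@pt_foldr E (seq Y) Y _ _ _ (fun e y s => if f e y then y :: s else s)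
   (fun=> [::]) l (fun p => sz p + 1)) => //.
- by polyb.
- by move=> e y s /=; case: (f e y); rewrite !szE /=; lia.
- have h : PT (fun p : E * Y * seq Y => f p.1.1 p.1.2).
    by apply: (@pt_comp _ _ _ _ _ _ (fun p : E * Y => f p.1 p.2)
      (fun p : E * Y * seq Y => p.1)) => //; pt.
  by pt.
- exact: pt_const.
Qed.

Lemma pt_all (f : E -> Y -> bool) (l : E -> seq Y) :
  PT (fun p : E * Y => f p.1 p.2) -> PT l -> PT (fun e => all (f e) (l e)).
Proof.
move=> hf hl.
apply: (@eq_pt _ _ _ _ (fun e => foldr (fun y b => f e y && b) true (l e))) => //.
apply: (@pt_foldr E bool Y _ _ _ (fun e y b => f e y && b)
   (fun=> true) l (fun p => 0)) => //.
- by polyb.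
- have h : PT (fun p : E * Y * bool => f p.1.1 p.1.2).
    by apply: (@pt_comp _ _ _ _ _ _ (fun p : E * Y => f p.1 p.2)
      (fun p : E * Y * bool => p.1)) => //; pt.
  by pt.
- exact: pt_const.
Qed.

Lemma pt_has (f : E -> Y -> bool) (l : E -> seq Y) :
  PT (fun p : E * Y => f p.1 p.2) -> PT l -> PT (fun e => has (f e) (l e)).
Proof.
move=> hf hl.
apply: (@eq_pt _ _ _ _ (fun e => ~~ all (fun y => ~~ f e y) (l e))).
  by move=> e; elim: (l e) => //= y s <-; rewrite negb_and negbK.
by have h : PT (fun e => all (fun y => ~~ f e y) (l e));
  [apply: (@pt_all (fun e y => ~~ f e y)) => //; pt | pt].
Qed.

End MoreListRules.

(** A Mealy transducer whose final state emits a tail; it serves both the carry-based arithmetic and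
    the numbering of the variables. *)
Fixpoint mealy (S Y Z : Type) (st : S -> Y -> S) (out : S -> Y -> Z) (fin : S -> seq Z) (s : S)
    (l : seq Y) : seq Z :=
  if l is y :: l' then out s y :: mealy st out fin (st s y) l' else fin s.

(** The size of an output letter depends on the current state, hence on the accumulator, and
    [pt_foldl] does not apply. The state is bounded along the run, then each letter in terms of that
    bound. *)
Lemma pt_mealy E S Y Z `{Code E} `{Code S} `{Code Y} `{Code Z}
    (st : S -> Y -> S) (out : S -> Y -> Z) (fin : S -> seq Z) (s : E -> S) (l : E -> seq Y) (B : Y -> nat) :
  polyb B -> (forall s y, sz (st s y) <= sz s + B y) ->
  PT (fun p : S * Y => st p.1 p.2) -> PT (fun p : S * Y => out p.1 p.2) ->
  PT fin -> PT s -> PT l -> PT (fun e => mealy st out fin (s e) (l e)).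
Proof.
move=> [d hd] hB hst hout hfin hs hl.
pose F (p : S * seq Z) y := (st p.1 y, out p.1 y :: p.2).
have FE s0 t l0 : foldl F (s0, t) l0 =
    (foldl st s0 l0, rev (mealy st out (fun=> [::]) s0 l0) ++ t).
  by elim: l0 s0 t => //= y l0 IH s0 t; rewrite IH rev_cons cat_rcons.
apply: (@eq_pt _ _ _ _ (fun e => let p := foldl F (s e, [::]) (l e) in
    rev p.2 ++ fin p.1)).
  move=> e; rewrite FE /= cats0 revK.
  by elim: (l e) (s e) => //= y l0 IH s0; rewrite -IH.
enough (hF : PT (fun e => foldl F (s e, [::]) (l e))).
  apply: (@pt_comp _ _ _ _ _ _ (fun p : S * seq Z => rev p.2 ++ fin p.1) _ _ hF).
  by apply: pt_cat; pt.
have [d2 hd2] := pt_polyb hout.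
(* [M] bounds every state reached and [N] a letter emitted from such a state, its list node
   included. *)
pose (M := fun e => sz (s e) + sz (l e) * (sz (l e) + 2) ^ d).
pose (N := fun e => (M e + sz (l e) + 3) ^ d2 + 1).
pose proof (pt_polyb hl) as hszl; pose proof (pt_polyb hs) as hszs.
apply: (@pt_foldl_bounded _ _ _ _ _ _ (fun=> F) (fun e => (s e, [::])) l
  (fun e => M e + (sz (l e) * N e + 2))) => //.
- by rewrite /F; pt.
- by pt.
- by rewrite /N /M; polyb.
move=> e l1 l2 el.
enough (sz (foldl st (s e) l1) <= sz (s e) + size l1 * (sz (l e) + 2) ^ d /\
    sz (foldl F (s e, [::]) l1).2 <= size l1 * N e + 1) as [h1 h2].
  have hl1 : size l1 <= sz (l e).
    by rewrite (leq_trans _ (size_le_sz (l e))) // el size_cat leq_addr.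
  rewrite szE {1}FE [(_, _).1]/=.
  have h3 : size l1 * (sz (l e) + 2) ^ d <= sz (l e) * (sz (l e) + 2) ^ d.
    by rewrite leq_mul2r hl1 orbT.
  have h4 : size l1 * N e <= sz (l e) * N e by rewrite leq_mul2r hl1 orbT.
  by rewrite /M; lia.
elim/last_ind: l1 l2 el => [|l1 y IH] l2 el; first by rewrite /= !mul0n addn0.
rewrite cat_rcons in el; have [h1 h2] := IH _ el.
have szy : sz y < sz (l e).
  by pose proof (sz_cat l1 (y :: l2)) as h3; rewrite -el szE in h3;
    pose proof (sz_gt0 l1); lia.
have szl1 : size l1 <= sz (l e).
  by rewrite (leq_trans _ (size_le_sz (l e))) // el size_cat leq_addr.
rewrite !foldl_rcons size_rcons !mulSn; split.
  apply: leq_trans (hB _ _) _.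
  have : B y <= (sz (l e) + 2) ^ d.
    by apply: leq_trans (hd _) _; apply: leq_expr; lia.
  by lia.
rewrite {1}/F [(_, _).2]/= szE FE [(_, _).1]/=.
rewrite FE in h2.
have : sz (out (foldl st (s e) l1) y) < N e.
  rewrite /N addn1 ltnS; apply: leq_trans (hd2 (_, _)) _; apply: leq_expr.
  rewrite szE /=.
  have h5 : size l1 * (sz (l e) + 2) ^ d <= sz (l e) * (sz (l e) + 2) ^ d.
    by rewrite leq_mul2r szl1 orbT.
  by rewrite /M; lia.
by move: h2; rewrite [(_, _).2]/=; lia.
Qed.

Lemma pt_mem E (Y : eqType) `{Code E} `{Code Y} (a : E -> Y) (l : E -> seq Y) :
  injective (@code Y _) -> PT a -> PT l -> PT (fun e => a e \in l e).
Proof.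
move=> inj ha hl; apply: (@eq_pt _ _ _ _ (fun e => has (fun y => a e == y) (l e))).
  by move=> e; elim: (l e) => //= y s IH; rewrite in_cons IH.
by apply: pt_has => //; apply: pt_eq => //; pt.
Qed.

(** * The decision procedure *)

Ltac pt_list :=
  lazymatch goal with
  | |- PT (fun x => cat (@?a x) (@?b x)) => apply (@pt_cat _ _ _ _ a b)
  | |- PT (fun x => all (fun y => @?f x y) (@?l x)) => apply (@pt_all _ _ _ _ f l)
  | |- PT (fun x => has (fun y => @?f x y) (@?l x)) => apply (@pt_has _ _ _ _ f l)
  | |- PT (fun x => map (fun y => @?f x y) (@?l x)) => apply (@pt_map _ _ _ _ _ _ f l)
  | |- PT (fun x => filter (fun y => @?f x y) (@?l x)) => apply (@pt_filter _ _ _ _ f l)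
  | |- PT (fun x => in_mem (@?a x) (mem (@?l x))) => apply (@pt_mem _ _ _ _ a l); [code_inj | | ]
  | |- PT (fun x => encode_bit (@?a x)) => apply (@pt_if _ _ _ _ a (fun=> Bit1) (fun=> Bit0))
  end.
Ltac pt_user ::= first [pt_basic | pt_list].

(** * Binary arithmetic, least significant bit first *)

Notation bits := (seq bool).

Definition inc (y : bits) : bits :=
  mealy (fun c a => c && a) (fun c a => c (+) a) (fun c => if c then [:: true] else [::])
    true y.

(** The state consists of the carry and the unread bits of the second operand, padded with zeros by
    [head false]. The new carry is the majority of the two digits and the old carry; for subtraction
    the first digit is complemented. *)
Definition carry_add (s : bool * bits) (a : bool) : bool * bits :=
  ((a && (head false s.2 || s.1)) || (head false s.2 && s.1), behead s.2).
Definition carry_sub (s : bool * bits) (a : bool) : bool * bits :=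
  ((~~ a && (head false s.2 || s.1)) || (head false s.2 && s.1), behead s.2).
(* [c + (a + 2x) <= d + 2y] iff [c' + x <= y], where [c'] tells whether
   [a + c > d]. *)
Definition carry_le (s : bool * bits) (a : bool) : bool * bits :=
  ((~~ head false s.2 && (a || s.1)) || (a && s.1), behead s.2).
Definition digit (s : bool * bits) (a : bool) : bool :=
  a (+) (head false s.2 (+) s.1).

Definition add (x y : bits) : bits :=
  mealy carry_add digit (fun s => if s.1 then inc s.2 else s.2) (false, y) x.

Definition sub (x y : bits) : bits :=
  mealy carry_sub digit (fun=> [::]) (false, y) x.

(** After [x] is exhausted, a pending carry must be covered by a nonzero remainder of [y]. An
    initial carry turns the comparison into a strict one. *)
Definition leb (c : bool) (x y : bits) : bool :=
  let s := foldl carry_le (c, y) x in s.1 ==> has id s.2.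

Definition mul (x y : bits) : bits :=
  foldr (fun (a : bool) r => if a then add (false :: r) y else false :: r) [::] x.

Definition product (l : seq bits) : bits := foldr mul [:: true] l.

(** The fold returns the most significant bit; the initial value admits the empty numeral, which is
    zero. *)
Definition canonical (x : bits) : bool := foldl (fun _ a => a) true x.

Lemma sz_behead X `{Code X} (l : seq X) : sz (behead l) <= sz l.
Proof. by case: l => //= x l; rewrite szE; lia. Qed.

Lemma pt_inc : PT inc.
Proof.
apply: (@pt_mealy _ _ _ _ _ _ _ _ _ _ _ (fun=> true) (fun y => y) (fun=> 0)) => //.
- by polyb.
- by pt.
- by pt.
- by pt.
- by pt.
- by pt.
Qed.

Ltac pt_inc' := lazymatch goal with
  | |- PT (fun x => inc (@?a x)) => pt1 inc pt_inc a
  end.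
Ltac pt_user ::= first [pt_basic | pt_list | pt_inc'].

Lemma pt_add : PT (fun p => add p.1 p.2).
Proof.
apply: (@pt_mealy _ _ _ _ _ _ _ _ _ _ _ (fun p => (false, p.2)) (fun p => p.1) (fun=> 0)) => //.
- by polyb.
- move=> [c y] a; rewrite !szE /=; pose proof (sz_behead y); lia.
- by rewrite /carry_add; pt.
- by rewrite /digit; pt.
- by pt.
- by pt.
- by pt.
Qed.

Lemma pt_sub : PT (fun p => sub p.1 p.2).
Proof.
apply: (@pt_mealy _ _ _ _ _ _ _ _ _ _ _ (fun p => (false, p.2)) (fun p => p.1) (fun=> 0)) => //.
- by polyb.
- move=> [c y] a; rewrite !szE /=; pose proof (sz_behead y); lia.
- by rewrite /carry_sub; pt.
- by rewrite /digit; pt.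
- by pt.
- by pt.
- by pt.
Qed.

Lemma pt_leb c : PT (fun p => leb c p.1 p.2).
Proof.
have h : PT (fun p : bits * bits => foldl carry_le (c, p.2) p.1).
  apply: (@pt_foldl _ _ _ _ _ _ (fun=> carry_le) (fun p => (c, p.2)) (fun p => p.1) (fun=> 0)).
  - by polyb.
  - by move=> _ [d y] a; rewrite !szE /=; pose proof (sz_behead y); lia.
  - by rewrite /carry_le; pt.
  - by pt.
  - by pt.
rewrite /leb; apply: (@pt_comp _ _ _ _ _ _ (fun s : bool * bits => s.1 ==> has id s.2) _ _ h).
by pt.
Qed.

Lemma pt_canonical : PT canonical.
Proof.
apply: (@pt_foldl _ _ _ _ _ _ (fun _ _ a => a) (fun=> true) (fun l => l) (fun=> 0)) => //.
- by polyb.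
- by pt.
- by pt.
- by pt.
Qed.

Lemma sz_bits (x : bits) : sz x = (size x).*2.+1.
Proof. by elim: x => // a x IH; rewrite !szE IH /=; lia. Qed.

Lemma size_mealy_inc c y : size (mealy (fun c a => c && a) (fun c a => c (+) a)
  (fun c => if c then [:: true] else [::]) c y) <= (size y).+1.
Proof. by elim: y c => [|a y IH] [] //=; apply: IH. Qed.

Lemma size_mealy_add c x y :
  size (mealy carry_add digit (fun s => if s.1 then inc s.2 else s.2) (c, y) x) <=
  (maxn (size x) (size y)).+1.
Proof.
elim: x c y => [|a x IH] c y /=.
  by rewrite max0n; case: c => //; apply: size_mealy_inc.
by apply: leq_trans (IH _ _) _; rewrite size_behead /=; lia.
Qed.

(** Each bit of [x] lengthens the result by at most two. As [size y] has coefficient one, [product]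
    may accumulate in [y] under the fold rule. *)
Lemma size_mul x y : size (mul x y) <= (size x).*2 + size y.
Proof.
elim: x => //= -[] x IH; last by rewrite /=; lia.
by apply: leq_trans (size_mealy_add _ _ _) _; rewrite /=; lia.
Qed.

Ltac pt_bits := lazymatch goal with
  | |- PT (fun x => add (@?a x) (@?b x)) => pt2 add pt_add a b
  | |- PT (fun x => sub (@?a x) (@?b x)) => pt2 sub pt_sub a b
  | |- PT (fun x => leb ?c (@?a x) (@?b x)) => pt2 (leb c) (pt_leb c) a b
  | |- PT (fun x => canonical (@?a x)) => pt1 canonical pt_canonical a
  end.
Ltac pt_user ::= first [pt_basic | pt_list | pt_inc' | pt_bits].

Lemma pt_mul : PT (fun p => mul p.1 p.2).
Proof.
apply: (@pt_foldr _ _ _ _ _ _ (fun (p : bits * bits) (a : bool) r =>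
  if a then add (false :: r) p.2 else false :: r) (fun=> [::]) (fun p => p.1)
  (fun p => sz p.1 + 4)).
- apply: (@polyb_le _ _ _ (fun p => sz p + 4)); last by polyb.
  by move=> p; rewrite !szE; lia.
- move=> [x y] a r /=; rewrite !szE !sz_bits.
  have := size_mealy_add false (false :: r) y; rewrite -/(add _ _) /= => h.
  by case: a => /=; lia.
- by pt.
- by pt.
- by pt.
Qed.

Lemma pt_product : PT product.
Proof.
apply: (@pt_foldr _ _ _ _ _ _ (fun=> mul) (fun=> [:: true]) (fun l => l)
  (fun p => 2 * sz p)).
- by polyb.
- by move=> e x r; rewrite szE !sz_bits /=; have := size_mul x r; lia.
- exact: (@pt_comp _ _ _ _ _ _ (fun p => mul p.1 p.2)
    (fun p : seq bits * bits * bits => (p.1.2, p.2)) pt_mul ltac:(pt)).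
- by pt.
- by pt.
Qed.

(** * Parsing and checking of strings *)

Section Cut.

Context (X : Type) {HX : Code X} (h : X -> bool).

Definition cut_step (a : X) (st : seq X * seq (X * seq X)) :=
  if h a then ([::], (a, st.1) :: st.2) else (a :: st.1, st.2).

(* [cut s] is the part of [s] before the first element satisfying [h], and the
   list of these elements, each with the part that follows it. *)
Definition cut (s : seq X) : seq X * seq (X * seq X) :=
  foldr cut_step ([::], [::]) s.

Lemma pt_cut : PT h -> PT cut.
Proof.
move=> hh; apply: (@pt_foldr _ _ _ _ _ _ (fun=> cut_step) (fun=> ([::], [::]))
  (fun l => l) (fun p => sz p.2 + 3)).
- apply: (@polyb_le _ _ _ (fun p => sz p + 3)); last by polyb.
  by move=> p; rewrite szE; lia.
- by move=> e y [s t] /=; rewrite /cut_step; case: (h y); do 4!rewrite ?szE /=; rewrite ?sz_nil; lia.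
- by rewrite /cut_step; pt.
- by pt.
- by pt.
Qed.

End Cut.

Notation str := (seq symbol).
Notation chunk := (symbol * str)%type.
Notation group := (chunk * seq chunk)%type.
Notation node := (str * (seq str * (bits * bits)))%type.

Definition is_head (a : symbol) : bool := a \notin [:: Bit0; Bit1; SEnd].
Definition is_end (a : symbol) : bool := a == SEnd.
Definition opens (c : chunk) : bool :=
  c.1 \in [:: SDefiniens; SAssess; SSection].

Definition numeral (x : bits) : str := [seq encode_bit a | a <- x] ++ [:: SEnd].

Definition read_bits (s : str) : bits := [seq a == Bit1 | a <- s].
Definition read_num (s : str) : bits := read_bits (cut is_end s).1.
Definition read_den (s : str) : bits :=
  read_bits (head (SEnd, [::]) (cut is_end s).2).2.

(** Re-encoding what was read and comparing it with [s] excludes stray symbols; canonicity then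
    excludes redundant zeros. *)
Definition fraction_ok (s : str) : bool :=
  [&& s == numeral (read_num s) ++ numeral (read_den s),
      canonical (read_num s), canonical (read_den s), has id (read_den s) &
      leb false (read_num s) (read_den s)].

Definition token_ok (op : symbol) (names : seq str) (c : chunk) : bool :=
  (c == (op, [::])) || (c.1 == SPrp) && (c.2 \in names).

(* Polish notation is read from right to left: a proposition adds an operand, a
   connective replaces two operands by one.  The operands are counted in unary. *)
Definition polish_step (c : chunk) (st : bool * bits) : bool * bits :=
  if c.1 == SPrp then (st.1, true :: st.2)
  else (st.1 && ~~ nilp (behead st.2), behead st.2).

Definition polish (s : seq chunk) : bool * bits :=
  foldr polish_step (true, [::]) s.

Definition formula_ok (op : symbol) (names : seq str) (s : seq chunk) : bool :=
  all (fun c => token_ok op names c) s &&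
  ((polish s).1 && (~~ nilp (polish s).2 && nilp (behead (polish s).2))).

Definition clause_ok (op : symbol) (names : seq str) (g : group) : bool :=
  if g.1.1 == SDefiniens then nilp g.1.2 && formula_ok op names g.2
  else [&& g.1.1 == SAssess, fraction_ok g.1.2 & nilp g.2].

Definition assign_ok (b : bool) (names : seq str) (c : chunk) : bool :=
  [&& c.1 == SAssign, head SEnd c.2 == encode_bit b & behead c.2 \in names].

(* A variable with a definition axiom weighs 1, since its value is forced by those
   of its parents; for negative assignments an assessment contributes [1 - alpha]. *)
Definition weight (b : bool) (c : chunk) : bits * bits :=
  if c.1 == SAssess then
    (if b then read_num c.2 else sub (read_den c.2) (read_num c.2), read_den c.2)
  else ([:: true], [:: true]).

(** Variables are kept as strings: canonical numerals are injective, so the graph is explored by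
    comparing names. *)
Definition mk_node (b : bool) (i : bits) (g : group) : node :=
  (numeral i, ([seq c.2 | c <- [seq c <- g.2 | c.1 == SPrp]], weight b g.1)).

Definition mk_nodes (b : bool) (s : seq group) : seq node :=
  mealy (fun i _ => inc i) (mk_node b) (fun=> [::]) [::] s.

(** Two levels of cutting: a chunk is a non-numeral symbol with the numeral symbols after it, and a
    group is a chunk that opens a clause or a section with the chunks it governs. *)
Definition groups (s : str) : seq group := (cut opens (cut is_head s).2).2.
Definition no_group : group := ((SEnd, [::]), [::]).

(** The number of clauses is not written in the string, so the three sections are located from the
    end. *)
Definition last_group (s : seq group) := head no_group (rev s).
Definition evidence_group (s : seq group) := head no_group (behead (rev s)).
Definition query_group (s : seq group) := head no_group (behead (behead (rev s))).
Definition clause_groups (s : seq group) := rev (behead (behead (behead (rev s)))).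

Definition section_ok (b : bool) (names : seq str) (g : group) : bool :=
  (g.1 == (SSection, [::])) && all (fun c => assign_ok b names c) g.2.

Definition names_of (nodes : seq node) : seq str := [seq nd.1 | nd <- nodes].

Definition op_of (b : bool) : symbol := if b then SAnd else SOr.

Definition groups_ok (b : bool) (names : seq str) (s : seq group) : bool :=
  [&& section_ok b names (query_group s), section_ok b names (evidence_group s),
      (last_group s).1.1 == SSection, fraction_ok (last_group s).1.2,
      nilp (last_group s).2 &
      all (fun g => clause_ok (op_of b) names g) (clause_groups s)].

Definition well_formed (b : bool) (s : str) : bool :=
  [&& nilp (cut is_head s).1, nilp (cut opens (cut is_head s).2).1 &
      groups_ok b (names_of (mk_nodes b (clause_groups (groups s)))) (groups s)].

Definition mark (M : seq str) (nd : node) : seq str :=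
  if nd.1 \in M then nd.2.1 ++ M else M.
Definition mark_all (nodes : seq node) (M : seq str) : seq str := foldl mark M nodes.
(* One round per node suffices: a simple path has fewer edges than there are
   nodes. *)
Definition ancestors (nodes : seq node) (M : seq str) : seq str :=
  foldl (fun M (_ : node) => mark_all nodes M) M nodes.

Definition acyclic_ok (nodes : seq node) : bool :=
  all (fun nd => ~~ (nd.1 \in ancestors nodes nd.2.1)) nodes.

Definition positive_ok (nodes : seq node) (M : seq str) : bool :=
  all (fun nd => (nd.1 \in M) ==> has id nd.2.2.1) nodes.

Definition relevant (nodes : seq node) (MQ ME : seq str) : seq node :=
  [seq nd <- nodes | (nd.1 \in MQ) && ~~ (nd.1 \in ME)].

Definition exceeds (l : seq node) (num den : bits) : bool :=
  leb true (product (num :: [seq nd.2.2.2 | nd <- l]))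
    (product (den :: [seq nd.2.2.1 | nd <- l])).

Definition decide_core (nodes : seq node) (q e : seq str) (num den : bits) : bool :=
  [&& acyclic_ok nodes, positive_ok nodes (ancestors nodes e) &
      exceeds (relevant nodes (ancestors nodes (q ++ e)) (ancestors nodes e)) num den].

Definition assigned (g : group) : seq str := [seq behead c.2 | c <- g.2].

Definition decide (b : bool) (s : str) : bool :=
  well_formed b s &&
  decide_core (mk_nodes b (clause_groups (groups s)))
    (assigned (query_group (groups s))) (assigned (evidence_group (groups s)))
    (read_num (last_group (groups s)).1.2) (read_den (last_group (groups s)).1.2).

(** * The decision procedure runs in polynomial time *)

Lemma pt_cut_head : PT (cut is_head).
Proof. by apply: pt_cut; apply: pt_symbol. Qed.

Lemma pt_cut_end : PT (cut is_end).
Proof. by apply: pt_cut; apply: pt_symbol. Qed.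

Lemma pt_opens : PT opens.
Proof.
exact: (@pt_comp _ _ _ _ _ _ (fun a => a \in [:: SDefiniens; SAssess; SSection])
  (fun c : chunk => c.1) (pt_symbol _) ltac:(pt)).
Qed.

Lemma pt_cut_opens : PT (cut opens).
Proof. by apply: pt_cut; apply: pt_opens. Qed.

Ltac pt_str := lazymatch goal with
  | |- PT (fun x => cut is_head (@?a x)) => pt1 (cut is_head) pt_cut_head a
  | |- PT (fun x => cut is_end (@?a x)) => pt1 (cut is_end) pt_cut_end a
  | |- PT (fun x => cut opens (@?a x)) => pt1 (cut opens) pt_cut_opens a
  | |- PT (fun x => product (@?a x)) => pt1 product pt_product a
  | |- PT (fun x => numeral (@?a x)) => unfold numeral
  | |- PT (fun x => read_num (@?a x)) => unfold read_num
  | |- PT (fun x => read_den (@?a x)) => unfold read_den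
  | |- PT (fun x => read_bits (@?a x)) => unfold read_bits
  end.
Ltac pt_user ::= first [pt_basic | pt_list | pt_inc' | pt_bits | pt_str].

Lemma pt_fraction_ok : PT fraction_ok.
Proof. by rewrite /fraction_ok; pt. Qed.

Lemma pt_polish : PT polish.
Proof.
apply: (@pt_foldr _ _ _ _ _ _ (fun=> polish_step) (fun=> (true, [::]))
  (fun l => l) (fun p => 2)).
- by polyb.
- move=> e y [c s] /=; rewrite /polish_step; pose proof (sz_behead s).
  by case: ifP => _; do 4!rewrite ?szE /=; lia.
- by rewrite /polish_step; pt.
- by pt.
- by pt.
Qed.

Ltac pt_ok := lazymatch goal with
  | |- PT (fun x => fraction_ok (@?a x)) => pt1 fraction_ok pt_fraction_ok a
  | |- PT (fun x => polish (@?a x)) => pt1 polish pt_polish a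
  | |- PT (fun x => token_ok _ (@?a x) (@?b x)) => unfold token_ok
  | |- PT (fun x => formula_ok _ (@?a x) (@?b x)) => unfold formula_ok
  | |- PT (fun x => clause_ok _ (@?a x) (@?b x)) => unfold clause_ok
  | |- PT (fun x => assign_ok _ (@?a x) (@?b x)) => unfold assign_ok
  | |- PT (fun x => section_ok _ (@?a x) (@?b x)) => unfold section_ok
  | |- PT (fun x => last_group (@?a x)) => unfold last_group
  | |- PT (fun x => evidence_group (@?a x)) => unfold evidence_group
  | |- PT (fun x => query_group (@?a x)) => unfold query_group
  | |- PT (fun x => clause_groups (@?a x)) => unfold clause_groups
  | |- PT (fun x => groups (@?a x)) => unfold groups
  | |- PT (fun x => names_of (@?a x)) => unfold names_of
  | |- PT (fun x => assigned (@?a x)) => unfold assigned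
  end.
Ltac pt_user ::= first [pt_basic | pt_list | pt_inc' | pt_bits | pt_str | pt_ok].

Lemma pt_groups_ok b : PT (fun p => groups_ok b p.1 p.2).
Proof. by rewrite /groups_ok; pt. Qed.

Lemma pt_mk_node b : PT (fun p => mk_node b p.1 p.2).
Proof. by rewrite /mk_node /weight; case: b; pt. Qed.

Lemma pt_mk_nodes b : PT (mk_nodes b).
Proof.
apply: (@pt_mealy _ _ _ _ _ _ _ _ (fun i _ => inc i) (mk_node b) (fun=> [::])
  (fun=> [::]) (fun s => s) (fun=> 2)) => //.
- by polyb.
- by move=> i g; rewrite !sz_bits; have := size_mealy_inc true i; rewrite -/(inc i); lia.
- by pt.
- exact: pt_mk_node.
- by pt.
- by pt.
- by pt.
Qed.

Ltac pt_nodes := lazymatch goal with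
  | |- PT (fun x => groups_ok ?b (@?a x) (@?c x)) => pt2 (groups_ok b) (pt_groups_ok b) a c
  | |- PT (fun x => mk_nodes ?b (@?a x)) => pt1 (mk_nodes b) (pt_mk_nodes b) a
  end.
Ltac pt_user ::= first [pt_basic | pt_list | pt_inc' | pt_bits | pt_str | pt_ok | pt_nodes].

Lemma pt_well_formed b : PT (well_formed b).
Proof. by rewrite /well_formed; pt. Qed.

Lemma pt_mark_all : PT (fun p => mark_all p.1 p.2).
Proof.
apply: (@pt_foldl _ _ _ _ _ _ (fun=> mark) (fun p => p.2) (fun p => p.1)
  (fun p => sz p.2)).
- by apply: (@polyb_le _ _ _ (fun p => sz p)); [move=> p; rewrite !szE; lia | polyb].
- move=> e M nd /=; rewrite /mark; case: ifP => _; last by lia.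
  by pose proof (sz_cat nd.2.1 M); rewrite !szE; lia.
- by rewrite /mark; pt.
- by pt.
- by pt.
Qed.

(** Each node prepends its list of parents at most once per round, so a round adds an amount
    independent of [M], even though marked names may be repeated. *)
Lemma sz_mark_all nodes M : sz (mark_all nodes M) <= sz M + sz nodes.
Proof.
elim: nodes M => [|nd nodes IH] M /=; first by lia.
apply: leq_trans (IH _) _; rewrite /mark; case: ifP => _; rewrite !szE; last by lia.
by pose proof (sz_cat nd.2.1 M); lia.
Qed.

Lemma pt_ancestors : PT (fun p => ancestors p.1 p.2).
Proof.
apply: (@pt_foldl _ _ _ _ _ _ (fun p M _ => mark_all p.1 M) (fun p => p.2)
  (fun p => p.1) (fun p => sz p)).
- by polyb.
- move=> [nodes M0] M nd /=; rewrite !szE /=.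
  by apply: leq_trans (sz_mark_all _ _) _; lia.
- exact: (@pt_comp _ _ _ _ _ _ (fun p => mark_all p.1 p.2)
    (fun p : seq node * seq str * seq str * node => (p.1.1.1, p.1.2)) pt_mark_all ltac:(pt)).
- by pt.
- by pt.
Qed.

Ltac pt_core := lazymatch goal with
  | |- PT (fun x => ancestors (@?a x) (@?c x)) => pt2 ancestors pt_ancestors a c
  | |- PT (fun x => well_formed ?b (@?a x)) => pt1 (well_formed b) (pt_well_formed b) a
  | |- PT (fun x => acyclic_ok (@?a x)) => unfold acyclic_ok
  | |- PT (fun x => positive_ok (@?a x) (@?b x)) => unfold positive_ok
  | |- PT (fun x => relevant (@?a x) (@?b x) (@?c x)) => unfold relevant
  | |- PT (fun x => exceeds (@?a x) (@?b x) (@?c x)) => unfold exceeds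
  end.
Ltac pt_user ::= first [pt_basic | pt_list | pt_inc' | pt_bits | pt_str | pt_ok
  | pt_nodes | pt_core].

Lemma pt_decide_core : PT (fun p : seq node * (seq str * (seq str * (bits * bits))) =>
  decide_core p.1 p.2.1 p.2.2.1 p.2.2.2.1 p.2.2.2.2).
Proof. by rewrite /decide_core; pt. Qed.

Lemma pt_decide b : PT (decide b).
Proof.
have h : PT (fun s => decide_core (mk_nodes b (clause_groups (groups s)))
    (assigned (query_group (groups s))) (assigned (evidence_group (groups s)))
    (read_num (last_group (groups s)).1.2) (read_den (last_group (groups s)).1.2)).
  apply: (@pt_comp _ _ _ _ _ _
    (fun p : seq node * (seq str * (seq str * (bits * bits))) =>
       decide_core p.1 p.2.1 p.2.2.1 p.2.2.2.1 p.2.2.2.2)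
    (fun s => (mk_nodes b (clause_groups (groups s)),
      (assigned (query_group (groups s)), (assigned (evidence_group (groups s)),
      (read_num (last_group (groups s)).1.2, read_den (last_group (groups s)).1.2)))))
    pt_decide_core).
  by pt.
by rewrite /decide; pt.
Qed.

(** * Numerals and the decomposition of strings *)

Definition bval (x : bits) : nat := foldr (fun (a : bool) v => a + v.*2) 0 x.

Lemma bval_inc_from (c : bool) y : bval (mealy (fun c a => c && a) (fun c a => c (+) a)
  (fun c => if c then [:: true] else [::]) c y) = c + bval y.
Proof. by elim: y c => [|a y IH] c /=; [case: c | rewrite IH; case: c; case: a; lia]. Qed.

Lemma bval_inc y : bval (inc y) = (bval y).+1.
Proof. exact: bval_inc_from. Qed.

Lemma bval_behead y : bval y = head false y + (bval (behead y)).*2.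
Proof. by case: y. Qed.

Lemma bval_add_from (c : bool) x y :
  bval (mealy carry_add digit (fun s => if s.1 then inc s.2 else s.2) (c, y) x) =
  c + bval x + bval y.
Proof.
elim: x c y => [|a x IH] c y /=; first by case: c => //=; rewrite bval_inc addn0.
rewrite IH (bval_behead y) /digit /=.
by case: a; case: c; case: (head false y) => /=; lia.
Qed.

Lemma bval_add x y : bval (add x y) = bval x + bval y.
Proof. exact: bval_add_from. Qed.

Lemma bval_sub_from (c : bool) x y : c + bval y <= bval x ->
  bval (mealy carry_sub digit (fun=> [::]) (c, y) x) = bval x - (c + bval y).
Proof.
elim: x c y => [|a x IH] c y /=; first by lia.
rewrite (bval_behead y) /digit /= => h; rewrite IH; move: h;
by case: a; case: c; case: (head false y) => /=; lia.
Qed.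

Lemma bval_sub x y : bval y <= bval x -> bval (sub x y) = bval x - bval y.
Proof. by move=> h; rewrite /sub bval_sub_from. Qed.

Lemma bval_gt0 x : has id x = (0 < bval x).
Proof. by elim: x => //= a x ->; case: a => //=; rewrite add0n double_gt0. Qed.

Lemma lebE c x y : leb c x y = (c + bval x <= bval y).
Proof.
rewrite /leb; elim: x c y => [|a x IH] c y /=.
  by rewrite bval_gt0; case: c => /=; lia.
rewrite IH (bval_behead y) /=.
by case: a; case: c; case: (head false y) => /=; lia.
Qed.

Lemma bval_mul x y : bval (mul x y) = bval x * bval y.
Proof. by elim: x => //= -[] x IH; rewrite ?bval_add /= IH; lia. Qed.

Lemma bval_product (l : seq bits) : bval (product l) = \prod_(x <- l) bval x.
Proof. by elim: l => [|x l IH]; rewrite ?big_nil // big_cons /= bval_mul IH. Qed.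

Fixpoint pos_bits (p : positive) : bits :=
  match p with
  | xH => [:: true]
  | xO q => false :: pos_bits q
  | xI q => true :: pos_bits q
  end.

Definition nat_bits (m : nat) : bits :=
  if bin_of_nat m is Npos p then pos_bits p else [::].

Lemma encode_natE m : encode_nat m = numeral (nat_bits m).
Proof.
rewrite /encode_nat /nat_bits /numeral; case: (bin_of_nat m) => // p.
by congr (_ ++ _); elim: p => //= p ->.
Qed.

Lemma bval_pos_bits p : bval (pos_bits p) = nat_of_pos p.
Proof. by elim: p => //= p ->; rewrite NatTrec.doubleE. Qed.

Lemma nat_bitsK m : bval (nat_bits m) = m.
Proof.
rewrite -{2}(bin_of_natK m) /nat_bits; case: (bin_of_nat m) => //= p.
exact: bval_pos_bits.
Qed.

Lemma canonicalE x : canonical x = last true x.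
Proof. by rewrite /canonical; elim: x true => /=. Qed.

Lemma canonical_pos_bits p : canonical (pos_bits p).
Proof.
rewrite canonicalE; elim: p => //= p; case: p => //=.
Qed.

Lemma canonical_nat_bits m : canonical (nat_bits m).
Proof.
by rewrite /nat_bits; case: (bin_of_nat m) => // p; exact: canonical_pos_bits.
Qed.

Lemma canonical_pos x : canonical x -> x != [::] -> exists p, x = pos_bits p.
Proof.
rewrite canonicalE; elim: x => // a x IH /= h _.
case: x IH h => [|b x] IH h; first by rewrite /= in h; rewrite h; exists xH.
have [p ->] := IH h isT.
by case: a {h}; [exists (xI p) | exists (xO p)].
Qed.

Lemma canonical_bvalK x : canonical x -> nat_bits (bval x) = x.
Proof.
have [-> //|nx cx] := eqVneq x [::].
have [p ->] := canonical_pos cx nx.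
by rewrite /nat_bits bval_pos_bits (nat_of_binK (Npos p)).
Qed.

Lemma canonical_inc x : canonical x -> canonical (inc x).
Proof.
rewrite !canonicalE; have h c y d : last true (d :: y) -> last true (mealy
    (fun c a => c && a) (fun c a => c (+) a)
    (fun c => if c then [:: true] else [::]) c (d :: y)).
  elim: y c d => [|a y IH] c d; first by rewrite /=; case: c; case: d.
  by move=> hl; have := IH (c && d) a hl.
by case: x => // d y hl; exact: h.
Qed.

(** Canonical numerals are determined by their value. Thus counting with [inc] produces exactly the
    names that [encode_nat] gives to the variables. *)
Lemma inc_nat_bits m : inc (nat_bits m) = nat_bits m.+1.
Proof.
rewrite -(canonical_bvalK (canonical_inc (canonical_nat_bits m))).
by rewrite bval_inc nat_bitsK.
Qed.

Lemma encode_bit_inj : injective encode_bit.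
Proof. by do 2!case. Qed.

Lemma numeral_inj : injective numeral.
Proof.
move=> x y; rewrite /numeral !cats1 => /rcons_inj[].
exact: (inj_map encode_bit_inj).
Qed.

Lemma encode_nat_inj : injective encode_nat.
Proof.
move=> m n; rewrite !encode_natE => /numeral_inj e.
by rewrite -(nat_bitsK m) e nat_bitsK.
Qed.

Definition flat (T : Type) (l : seq (T * seq T)) : seq T :=
  flatten [seq c.1 :: c.2 | c <- l].

Arguments flat : simpl never.

Lemma cutK (T : Type) (h : T -> bool) s : (cut h s).1 ++ flat (cut h s).2 = s.
Proof.
rewrite /cut; elim: s => //= a s IH; rewrite /cut_step; case: (h a) => /=.
  by rewrite /flat /= -/(flat _) IH.
by rewrite IH.
Qed.

(** Converse of [cutK]: a decomposition that respects the separators is the one that [cut] finds. *)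
Lemma cut_flat (T : Type) (h : T -> bool) s l :
  all (predC h) s -> all (fun c => h c.1 && all (predC h) c.2) l ->
  cut h (s ++ flat l) = (s, l).
Proof.
move=> hs hl; rewrite /cut.
have body t st : all (predC h) t -> foldr (cut_step h) st t = (t ++ st.1, st.2).
  by elim: t => [|a t IH] /=; [case: st | case/andP=> /negbTE ha /IH ->; rewrite /cut_step ha].
rewrite foldr_cat body //.
suff -> : foldr (cut_step h) ([::], [::]) (flat l) = ([::], l) by rewrite /= cats0.
elim: l hl => //= -[c t] l IH /= /andP[/andP[hc ht] hl].
rewrite /flat /= -/(flat l) foldr_cat IH // body //= /cut_step hc cats0 //.
Qed.

Lemma flat_cons (T : Type) (c : T * seq T) l : flat (c :: l) = c.1 :: c.2 ++ flat l.
Proof. by []. Qed.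

Lemma flat_cat (T : Type) (l1 l2 : seq (T * seq T)) : flat (l1 ++ l2) = flat l1 ++ flat l2.
Proof. by rewrite /flat map_cat flatten_cat. Qed.

(** * Probabilities of one-sided events *)

Lemma eval_eq n (w w' : 'I_n -> bool) f :
  {in props f, w =1 w'} -> eval w f = eval w' f.
Proof.
elim: f => [i|g IHg|g IHg h IHh|g IHg h IHh] /= e.
- by apply: e; rewrite mem_seq1.
- by rewrite IHg.
- by rewrite IHg ?IHh // => i hi; apply: e; rewrite mem_cat hi ?orbT.
- by rewrite IHg ?IHh // => i hi; apply: e; rewrite mem_cat hi ?orbT.
Qed.

Definition parents n (cl : 'I_n -> clause n) (i : 'I_n) : seq 'I_n :=
  if cl i is Definiens f then props f else [::].

Lemma edgeE n (cl : 'I_n -> clause n) j i : edge cl j i = (j \in parents cl i).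
Proof. by rewrite /edge /parents; case: (cl i). Qed.

Definition above n (cl : 'I_n -> clause n) (A : seq 'I_n) : {set 'I_n} :=
  [set i | has (fun a => connect (edge cl) i a) A].

Definition clause_weight n (b : bool) (c : clause n) : rat :=
  (if c is Assess a then (if b then value a else 1 - value a) else 1)%R.

(** The property shared by conjunctions for [b = true] and disjunctions for [b = false], and all
    that the computation of probabilities asks of the bodies. *)
Definition forced_by n (b : bool) (cl : 'I_n -> clause n) : Prop :=
  forall i f, cl i = Definiens f -> forall w : 'I_n -> bool,
    (eval w f == b) = all (fun j => w j == b) (props f).

Section Elimination.

Import GRing.Theory Num.Theory.
Local Open Scope ring_scope.

Context (n : nat) (B : specification n).

Local Notation parents := (parents (clause_of B)).
Local Notation above := (above (clause_of B)).

Definition parent_closed (T : {set 'I_n}) : Prop :=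
  forall i j, i \in T -> j \in parents i -> j \in T.

Definition agree_on (T : {set 'I_n}) (w0 : {ffun 'I_n -> bool}) : pred {ffun 'I_n -> bool} :=
  fun w => [forall i in T, w i == w0 i].

Definition update (w : {ffun 'I_n -> bool}) (i : 'I_n) (v : bool) :
  {ffun 'I_n -> bool} := [ffun j => if j == i then v else w j].

Lemma local_prob_eq (w w' : {ffun 'I_n -> bool}) i : w i = w' i -> {in parents i, w =1 w'} ->
  local_prob B w i = local_prob B w' i.
Proof.
rewrite /local_prob /parents => ei; case: (clause_of B i) => [f|a] e; last by rewrite ei.
by rewrite ei (eval_eq e).
Qed.

Lemma spec_acyclic i j : j \in parents i -> ~~ connect (edge (clause_of B)) i j.
Proof.
move=> h; have : acyclic (edge (clause_of B)) by case: B.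
by move=> /forallP /(_ j) /forallP /(_ i) /implyP; apply; rewrite edgeE.
Qed.

(** By acyclicity [i] is not its own parent, so changing its value leaves the body unchanged and
    exactly one value satisfies the axiom. *)
Lemma sum_local_prob w i : \sum_(v : bool) local_prob B (update w i v) i = 1.
Proof.
rewrite big_bool /= /local_prob.
case e: (clause_of B i) => [f|a]; rewrite !ffunE eqxx; last by rewrite subrKC.
have ev v : eval (update w i v) f = eval w f.
  apply: eval_eq => j hj; rewrite ffunE; case: eqP => // ej.
  have /spec_acyclic : j \in parents i by rewrite /parents e.
  by rewrite ej connect0.
by rewrite !ev; case: (eval w f); rewrite /= ?addr0 ?add0r.
Qed.

(** Take [i] outside [T] with the fewest ancestors. A parent outside [T] would have strictly fewer,
    since [i] is not among them by acyclicity. *)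
Lemma exists_next (T : {set 'I_n}) : T != setT ->
  exists2 i, i \notin T & {subset parents i <= T}.
Proof.
move=> nT.
have [i0 hi0] : exists i, i \notin T.
  apply/existsP; move: nT; apply: contraNT; rewrite negb_exists => /forallP h.
  by apply/eqP/setP=> i; rewrite inE; have := h i; rewrite negbK.
pose anc i := [set j | connect (edge (clause_of B)) j i].
case: (@arg_minnP _ i0 [pred i | i \notin T] (fun i => #|anc i|) hi0) => i /= hi hmin.
exists i => // j hj; apply: contraT => hjT.
have := hmin j hjT; rewrite leqNgt => /negP[]; apply: proper_card.
apply/properP; split.
  apply/subsetP=> k; rewrite !inE => hk; apply: connect_trans hk _.
  by apply: connect1; rewrite edgeE.
by exists i; rewrite inE ?connect0 //; apply: spec_acyclic.
Qed.

(* Unconstrained variables sum out one at a time, each once all its parents are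
   fixed. *)
Lemma sum_out (T : {set 'I_n}) w0 : parent_closed T ->
  \sum_(w | agree_on T w0 w) \prod_(i | i \notin T) local_prob B w i = 1.
Proof.
elim: {T}_.+1 {-2}T w0 (ltnSn #|~: T|) => // m IH T w0 hm hT.
have [eT|nT] := eqVneq T setT.
  rewrite (big_pred1 w0) => [|w].
    by rewrite big1 // => i; rewrite eT inE.
  apply/forall_inP/eqP => [h|->//]; apply/ffunP=> i.
  by apply/eqP/h; rewrite eT inE.
have [i hi hp] := exists_next nT.
rewrite (partition_big (fun w : {ffun 'I_n -> bool} => w i) predT) //=.
rewrite -[RHS](sum_local_prob w0 i); apply: eq_bigr => v _.
have eP w : agree_on T w0 w && (w i == v) = agree_on (i |: T) (update w0 i v) w.
  apply/andP/forall_inP => [[/forall_inP h /eqP hv] j|h].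
    rewrite ffunE in_setU1; case: (j =P i) => [->|_] /=; first by rewrite hv.
    exact: h.
  split; last by have := h i (setU11 _ _); rewrite ffunE eqxx.
  apply/forall_inP=> j hj; have := h j (setU1r _ hj); rewrite ffunE.
  by case: (j =P i) => // ej; rewrite -ej hj in hi.
rewrite (eq_bigl _ _ eP).
(* All parents of [i] lie in [T], where [w] agrees with [w0]; hence the factor of [i] is constant on
   this class and can be pulled out before the induction hypothesis applies to [i |: T]. *)
rewrite (eq_bigr (fun w => local_prob B (update w0 i v) i *
    \prod_(j | j \notin i |: T) local_prob B w j)) => [|w hw].
  rewrite -big_distrr /= IH ?mulr1 //.
    move: hm; rewrite ltnS; apply: leq_trans; apply: proper_card.
    apply/properP; split; first by rewrite setCS subsetU1.
    by exists i; rewrite !inE ?hi // eqxx.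
  move=> j k; rewrite !in_setU1 => /orP[/eqP -> /hp -> //|]; first by rewrite orbT.
  by move=> hj hk; rewrite (hT j k) ?orbT.
rewrite (bigD1 i) //=; congr (_ * _).
  have {}hw j : j \in i |: T -> w j = update w0 i v j.
    by move=> hj; apply/eqP; exact: (forall_inP hw).
  apply: local_prob_eq; first exact: hw (setU11 _ _).
  by move=> j /hp hj; apply: hw; exact: setU1r.
by apply: eq_bigl => j; rewrite in_setU1 negb_or andbC.
Qed.

Lemma above_closed A : parent_closed (above A).
Proof.
move=> i j; rewrite !inE => /hasP[a ha hc] hj; apply/hasP; exists a => //.
by apply: connect_trans hc; apply: connect1; rewrite edgeE.
Qed.

(** When all of [above A] equals [b], each factor there is its weight: a definition axiom holds
    because its propositions are again in [above A]. The other factors are removed by [sum_out]. *)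
Lemma Pr_forced b A : forced_by b (clause_of B) ->
  Pr B (event [seq (a, b) | a <- A]) =
  \prod_(i in above A) clause_weight b (clause_of B i).
Proof.
move=> hb; pose w0 : {ffun 'I_n -> bool} := [ffun=> b].
(* The two events may differ, but only on worlds that violate an axiom, which contribute zero to
   both sums. *)
have ext w : joint B w != 0 -> event [seq (a, b) | a <- A] w = agree_on (above A) w0 w.
  move=> hw; rewrite /event all_map; apply/allP/forall_inP => [h|h a ha] /=; last first.
    have := h a; rewrite ffunE; apply; rewrite inE; apply/hasP.
    by exists a => //; apply: connect0.
  move=> i; rewrite inE ffunE => /hasP[a ha /connectP[p]].
  (* The value [b] travels backwards along the path: the next vertex [k] has it, its factor is
     nonzero, so its axiom forces its parent [i]. *)
  elim: p i => [|k p IH] i /=; first by move=> _ <-; apply: h.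
  rewrite edgeE => /andP[hik hp] hl; have /eqP wk := IH _ hp hl.
  have : local_prob B w k != 0 by apply: contraNneq hw => h0; rewrite /joint (bigD1 k) //= h0 mul0r.
  move: hik; rewrite /local_prob /parents; case e: (clause_of B k) => [f|//] hik.
  rewrite wk [b == _]eq_sym (hb k f e); case: allP => [hf _|]; first exact: hf.
  by rewrite eqxx.
rewrite /Pr.
have -> : \sum_(w | event [seq (a, b) | a <- A] w) joint B w =
    \sum_(w | agree_on (above A) w0 w) joint B w.
  rewrite big_mkcond [RHS]big_mkcond; apply: eq_bigr => w _.
  have [-> |/ext -> //] := eqVneq (joint B w) 0.
  by do 2!case: ifP.
rewrite (eq_bigr (fun w => (\prod_(i in above A) clause_weight b (clause_of B i)) *
   \prod_(i | i \notin above A) local_prob B w i)) => [|w hw].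
  by rewrite -big_distrr /= sum_out ?mulr1 //; apply: above_closed.
rewrite /joint (bigID (mem (above A))) /=; congr (_ * _).
apply: eq_bigr => i hi.
have wb j : j \in above A -> w j = b.
  by move=> hj; have /eqP := forall_inP hw j hj; rewrite ffunE.
rewrite /local_prob /clause_weight (wb i hi).
case e: (clause_of B i) => [f|a] //.
rewrite [b == _]eq_sym (hb i f e).
have -> // : all (fun j => w j == b) (props f).
apply/allP=> j hj; apply/eqP/wb/(above_closed hi).
by rewrite /parents e.
Qed.

End Elimination.

(** * Correctness of the decision procedure *)

Definition op (b : bool) : connective := if b then Conj else Disj.

Definition in_language (b : bool) n (f : formula n) : bool :=
  Prop_language [:: op b] f.

Lemma in_languageE b n (f : formula n) :
  in_language b f = all (fun c => c == op b) (connectives f).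
Proof. by apply: eq_all => c; exact: mem_seq1. Qed.

Definition join (b : bool) n (g h : formula n) : formula n :=
  if b then And g h else Or g h.

(** Treats both languages at once: negation and the other connective are excluded, so every later
    induction has two cases whatever [b] is. *)
Lemma formula_join_ind b n (P : formula n -> Prop) :
  (forall i, P (Prp i)) ->
  (forall g h, in_language b g -> P g -> in_language b h -> P h -> P (join b g h)) ->
  forall f, in_language b f -> P f.
Proof.
move=> h1 h2; elim=> [i|g IHg|g IHg h IHh|g IHg h IHh] //=.
- by rewrite in_languageE /= => /andP[/eqP hb _]; case: b hb {h2 IHg}.
- rewrite in_languageE /= all_cat -!in_languageE => /and3P[/eqP hb lg lh].
  by case: b h2 IHg IHh lg lh hb => // h2 IHg IHh lg lh _; apply: h2; auto.
- rewrite in_languageE /= all_cat -!in_languageE => /and3P[/eqP hb lg lh].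
  by case: b h2 IHg IHh lg lh hb => // h2 IHg IHh lg lh _; apply: h2; auto.
Qed.

Lemma in_language_join b n (g h : formula n) :
  in_language b (join b g h) = in_language b g && in_language b h.
Proof. by rewrite !in_languageE; case: b; rewrite /= all_cat eqxx. Qed.

Lemma eval_in_language b n (f : formula n) : in_language b f ->
  forall w : 'I_n -> bool, (eval w f == b) = all (fun j => w j == b) (props f).
Proof.
move=> hf w; elim/(@formula_join_ind b): f / hf => [i|g h _ IHg _ IHh] /=.
  by rewrite andbT.
have -> : props (join b g h) = props g ++ props h by case: b {IHg IHh}.
rewrite all_cat -IHg -IHh.
by case: b {IHg IHh} => /=; case: (eval w g); case: (eval w h).
Qed.

(** * Encodings as lists of chunks and groups *)

Fixpoint tokens n (f : formula n) : seq chunk :=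
  match f with
  | Prp i => [:: (SPrp, encode_nat i)]
  | Not g => (SNot, [::]) :: tokens g
  | And g h => (SAnd, [::]) :: tokens g ++ tokens h
  | Or g h => (SOr, [::]) :: tokens g ++ tokens h
  end.

Lemma encode_formulaE n (f : formula n) : encode_formula f = flat (tokens f).
Proof.
elim: f => [i|g IHg|g IHg h IHh|g IHg h IHh] /=.
- by rewrite /flat /= cats0.
- by rewrite IHg.
- by rewrite IHg IHh -flat_cat.
- by rewrite IHg IHh -flat_cat.
Qed.

Definition clause_group n (c : clause n) : group :=
  match c with
  | Definiens f => ((SDefiniens, [::]), tokens f)
  | Assess a => ((SAssess, encode_fraction a), [::])
  end.

Definition assign_chunk n (b : bool) (i : 'I_n) : chunk :=
  (SAssign, encode_bit b :: encode_nat i).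

Definition section_group (b : bool) n (l : seq 'I_n) : group :=
  ((SSection, [::]), map (assign_chunk b) l).

Definition instance_groups (b : bool) n (cl : 'I_n -> clause n) (q e : seq 'I_n)
    (a : fraction) : seq group :=
  [seq clause_group (cl i) | i <- enum 'I_n] ++
  [:: section_group b q; section_group b e; ((SSection, encode_fraction a), [::])].

Lemma flat_clause n (c : clause n) : flat (flat [:: clause_group c]) = encode_clause c.
Proof.
case: c => [f|a] /=; first by rewrite /flat /= cats0 -/(flat _) encode_formulaE.
by rewrite /flat /= !cats0.
Qed.

Lemma flat_flat_map T (g : T -> group) (s : seq T) :
  flat (flat (map g s)) = flatten [seq flat (flat [:: g x]) | x <- s].
Proof.
elim: s => // x s IH.
have -> : flatten [seq flat (flat [:: g x]) | x <- x :: s] =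
  flat (flat [:: g x]) ++ flatten [seq flat (flat [:: g x]) | x <- s] by [].
by rewrite -IH -!flat_cat.
Qed.

Lemma flat_assign b n (l : seq 'I_n) :
  flatten [seq encode_assignment a | a <- [seq (i, b) | i <- l]] =
  flat (map (assign_chunk b) l).
Proof. by rewrite /flat -!map_comp. Qed.

Lemma encodeE b n (B : specification n) q e a :
  encode (Instance B [seq (i, b) | i <- q] [seq (i, b) | i <- e] a) =
  flat (flat (instance_groups b (clause_of B) q e a)).
Proof.
rewrite /encode /= !flat_assign /instance_groups 2!flat_cat flat_flat_map.
congr (_ ++ _); first by congr flatten; apply: eq_map => i; rewrite flat_clause.
rewrite 3!flat_cons flat_cons flat_cat flat_cons flat_cat flat_cons /=.
by rewrite cats0.
Qed.

Lemma is_headE a :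
  is_head a = match a with Bit0 | Bit1 | SEnd => false | _ => true end.
Proof. by rewrite /is_head !inE; case: a; do 3?case: eqP. Qed.

Lemma opensE c :
  opens c = match c.1 with SDefiniens | SAssess | SSection => true | _ => false end.
Proof. by rewrite /opens !inE; case: c.1; do 3?case: eqP. Qed.

Lemma numeral_no_head x : all (predC is_head) (numeral x).
Proof.
rewrite /numeral all_cat all_map; apply/andP; split; last by rewrite /= is_headE.
by apply/allP=> -[]; rewrite /= is_headE.
Qed.

Lemma encode_fraction_no_head a : all (predC is_head) (encode_fraction a).
Proof. by rewrite /encode_fraction !encode_natE all_cat !numeral_no_head. Qed.

Definition is_chunk (c : chunk) : bool := is_head c.1 && all (predC is_head) c.2.

Lemma tokens_chunks n (f : formula n) :
  all (fun c => is_chunk c && ~~ opens c) (tokens f).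
Proof.
elim: f => [i|g IHg|g IHg h IHh|g IHg h IHh] /=;
  rewrite ?all_cat ?IHg ?IHh /is_chunk is_headE opensE //=.
by rewrite encode_natE numeral_no_head.
Qed.

Lemma assign_chunks b n (l : seq 'I_n) :
  all (fun c => is_chunk c && ~~ opens c) (map (assign_chunk b) l).
Proof.
rewrite all_map; apply/allP=> i _ /=.
by rewrite /is_chunk is_headE opensE /= encode_natE numeral_no_head is_headE; case: b.
Qed.

Definition is_group (g : group) : bool :=
  [&& is_chunk g.1, opens g.1 & all (fun c => is_chunk c && ~~ opens c) g.2].

Lemma instance_groups_ok b n (cl : 'I_n -> clause n) q e a :
  all is_group (instance_groups b cl q e a).
Proof.
rewrite all_cat all_map /=; apply/andP; split.
  apply/allP=> i _ /=; case: (cl i) => [f|c] /=; rewrite /is_group /=.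
    by rewrite /is_chunk is_headE opensE tokens_chunks.
  by rewrite /is_chunk is_headE opensE /= encode_fraction_no_head.
by rewrite /is_group !assign_chunks /is_chunk !is_headE !opensE /= encode_fraction_no_head.
Qed.

(** Heads do not occur inside numerals, nor opening chunks inside the body of a group, so both cuts
    are inverted. *)
Lemma cut_groups gs : all is_group gs ->
  cut is_head (flat (flat gs)) = ([::], flat gs) /\ cut opens (flat gs) = ([::], gs).
Proof.
move=> h; split.
  apply: (@cut_flat _ is_head [::]) => //.
  elim: gs h => //= -[c l] gs IH /andP[/and3P[/= hc _ hl] /IH{}IH].
  rewrite /flat /= -/(flat gs) all_cat; apply/and3P; split=> //.
  by apply: sub_all hl => d /andP[].
apply: (@cut_flat _ opens [::]) => //.
by apply: sub_all h => -[c l] /and3P[/= _ -> hl]; apply: sub_all hl => d /andP[].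
Qed.

Lemma groups_flat gs : all is_group gs -> groups (flat (flat gs)) = gs.
Proof. by move=> h; have [h1 h2] := cut_groups h; rewrite /groups h1 h2. Qed.

Lemma nilP' (T : Type) (s : seq T) : nilp s -> s = [::].
Proof. by case: s. Qed.

Lemma well_formed_flat b s : well_formed b s ->
  s = flat (flat (groups s)).
Proof.
case/and3P=> /nilP' h1 /nilP' h2 _.
rewrite -{1}(cutK is_head s) h1 /=; congr flat.
by rewrite -{1}(cutK opens (cut is_head s).2) h2.
Qed.

Definition names (n : nat) : seq str := [seq encode_nat i | i <- iota 0 n].

Lemma namesP n s : reflect (exists i : 'I_n, s = encode_nat i) (s \in names n).
Proof.
apply: (iffP mapP) => [[i]|[i ->]]; last by exists (val i); rewrite ?mem_iota /=.
by rewrite mem_iota /= => hi ->; exists (Ordinal hi).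
Qed.

Lemma mk_nodesE b gs :
  mk_nodes b gs = [seq mk_node b (nat_bits p.1) p.2 | p <- zip (iota 0 (size gs)) gs].
Proof.
have gen k : mealy (fun i _ => inc i) (mk_node b) (fun=> [::]) (nat_bits k) gs =
    [seq mk_node b (nat_bits p.1) p.2 | p <- zip (iota k (size gs)) gs].
  by elim: gs k => //= g gs IH k; rewrite inc_nat_bits IH.
exact: gen 0.
Qed.

Lemma names_of_mk_nodes b gs : names_of (mk_nodes b gs) = names (size gs).
Proof.
have -> : names (size gs) =
    [seq encode_nat i | i <- unzip1 (zip (iota 0 (size gs)) gs)].
  by rewrite unzip1_zip // size_iota.
rewrite /names_of mk_nodesE -!map_comp.
by apply: eq_map => p /=; rewrite encode_natE.
Qed.

Definition node_of (b : bool) n (cl : 'I_n -> clause n) (i : 'I_n) : node :=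
  (encode_nat i, (map (fun j : 'I_n => encode_nat j) (parents cl i),
   weight b (clause_group (cl i)).1)).

Definition nodes_of (b : bool) n (cl : 'I_n -> clause n) : seq node :=
  map (node_of b cl) (enum 'I_n).

Lemma tokens_props n (f : formula n) :
  [seq c.2 | c <- [seq c <- tokens f | c.1 == SPrp]] =
  [seq encode_nat (j : 'I_n) | j <- props f].
Proof.
elim: f => [i|g IHg|g IHg h IHh|g IHg h IHh] /=; case: eqP => //= _.
- by rewrite filter_cat !map_cat IHg IHh.
- by rewrite filter_cat !map_cat IHg IHh.
Qed.

Lemma mk_nodes_clauses b n (cl : 'I_n -> clause n) :
  mk_nodes b [seq clause_group (cl i) | i <- enum 'I_n] = nodes_of b cl.
Proof.
rewrite mk_nodesE size_map size_enum_ord -val_enum_ord.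
have -> (s : seq 'I_n) : zip (map val s) [seq clause_group (cl i) | i <- s] =
    [seq (val i, clause_group (cl i)) | i <- s] by elim: s => //= i s ->.
rewrite -map_comp; apply: eq_map => i /=.
rewrite /mk_node /node_of encode_natE; congr (_, (_, _)).
by rewrite /parents; case: (cl i) => [f|a] //=; exact: tokens_props.
Qed.

(** * The syntax checks accept exactly the encodings *)

Lemma cut_numerals x y : cut is_end (numeral x ++ numeral y) =
  ([seq encode_bit a | a <- x], [:: (SEnd, [seq encode_bit a | a <- y]); (SEnd, [::])]).
Proof.
have no_end z : all (predC is_end) [seq encode_bit a | a <- z].
  by rewrite all_map; apply/allP=> -[] _; apply/eqP.
rewrite -(@cut_flat _ is_end [seq encode_bit a | a <- x]) ?no_end //; last first.
  by rewrite /= no_end /is_end eqxx.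
by congr cut; rewrite /numeral -!catA.
Qed.

Lemma read_bitsK x : read_bits [seq encode_bit a | a <- x] = x.
Proof. by rewrite /read_bits -map_comp map_id_in // => -[] _ /=; [exact: eqxx | exact/eqP]. Qed.

Lemma read_fraction a : read_num (encode_fraction a) = nat_bits (fnum a) /\
  read_den (encode_fraction a) = nat_bits (fden a).
Proof.
by rewrite /read_num /read_den /encode_fraction !encode_natE cut_numerals /= !read_bitsK.
Qed.

Lemma fraction_okP s : reflect (exists a, encode_fraction a = s) (fraction_ok s).
Proof.
apply: (iffP and5P) => [[/eqP es cn cd hd hle]|[a <-]].
  have ha : (0 < bval (read_den s)) && (bval (read_num s) <= bval (read_den s)).
    by rewrite -bval_gt0 hd; rewrite lebE in hle.
  exists (Fraction ha); rewrite /encode_fraction /= !encode_natE.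
  by rewrite !canonical_bvalK.
have [-> ->] := read_fraction a.
rewrite bval_gt0 lebE !nat_bitsK !canonical_nat_bits /encode_fraction !encode_natE.
by case: a => num den /= /andP[].
Qed.

Lemma polish_tokens b n (f : formula n) cs : in_language b f ->
  polish (tokens f ++ cs) = ((polish cs).1, true :: (polish cs).2).
Proof.
move=> hf; move: cs; elim/(@formula_join_ind b): f / hf => [i|g h _ IHg _ IHh] cs.
  by rewrite /= /polish_step eqxx.
have -> : tokens (join b g h) ++ cs = (op_of b, [::]) :: tokens g ++ tokens h ++ cs.
  by case: b {IHg IHh}; rewrite /= catA.
rewrite /= IHg IHh /polish_step /=.
by case: b {IHg IHh} => /=; case: eqP => //; rewrite andbT.
Qed.

Lemma tokens_ok b n (f : formula n) : in_language b f ->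
  all (fun c => token_ok (op_of b) (names n) c) (tokens f).
Proof.
move=> hf; elim/(@formula_join_ind b): f / hf => [i|g h _ IHg _ IHh] /=.
  by rewrite andbT /token_ok /= eqxx; apply/orP; right; apply/namesP; exists i.
have -> : tokens (join b g h) = (op_of b, [::]) :: tokens g ++ tokens h.
  by case: b {IHg IHh}.
by rewrite /= all_cat IHg IHh /token_ok eqxx.
Qed.

(** Generalised from one formula to a forest: reading from the right, the unary counter is the
    number of complete formulas found so far, and a connective joins the first two. *)
Lemma polish_complete b n cs :
  all (fun c => token_ok (op_of b) (names n) c) cs -> (polish cs).1 ->
  exists fs : seq (formula n), [/\ all (@in_language b n) fs,
    flatten (map (@tokens n) fs) = cs & size fs = size (polish cs).2].
Proof.
elim: cs => [|c cs IH] /=; first by exists [::].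
move=> /andP[hc /IH{}IH]; rewrite /polish_step; case/orP: hc => [/eqP ->|].
  have -> : ((op_of b, [::]) : chunk).1 == SPrp = false by case: b {IH}; apply/eqP.
  rewrite /= => /andP[/IH[fs [hl hcs hs]] hnil].
  case: fs hl hcs hs => [|g [|h fs]] hl hcs hs; try by move: hnil; case: (polish cs).2 hs => [|? []].
  exists (join b g h :: fs); split.
  - by move: hl; rewrite /= in_language_join andbA.
  - by rewrite -hcs; case: b {IH hl hcs}; rewrite /= catA.
  - by rewrite size_behead -hs.
case: c => k s /= /andP[/eqP -> /namesP[i ->]]; rewrite eqxx /=.
case/IH=> fs [hl hcs hs]; exists (Prp i :: fs); split=> //=.
- by rewrite hcs.
- by rewrite hs.
Qed.

Lemma formula_okP b n cs :
  reflect (exists2 f : formula n, in_language b f & tokens f = cs)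
    (formula_ok (op_of b) (names n) cs).
Proof.
apply: (iffP idP) => [/andP[hc /and3P[h1 h2 h3]]|[f hf <-]].
  have [fs [hl hcs hs]] := polish_complete hc h1.
  case: (polish cs).2 hs h2 h3 => [|a []] //; case: fs hl hcs => [|f []] //= hl hcs _ _ _.
  by exists f; [case/andP: hl | rewrite -hcs cats0].
rewrite /formula_ok tokens_ok //= -[tokens f]cats0.
by rewrite !(polish_tokens _ hf).
Qed.

Definition clause_in (b : bool) n (c : clause n) : bool :=
  if c is Definiens f then in_language b f else true.

Lemma clause_okP b n g :
  reflect (exists2 c : clause n, clause_in b c & clause_group c = g)
    (clause_ok (op_of b) (names n) g).
Proof.
rewrite /clause_ok; apply: (iffP idP) => [|[[f|a] /= hc <-]] /=; last first.
- by case: eqP => // _; rewrite eqxx andbT /=; apply/fraction_okP; exists a.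
- by rewrite eqxx /=; apply/formula_okP; exists f.
case: g => -[k s] l /=; case: eqP => [->|_].
  case/andP=> /nilP' -> /formula_okP[f hf <-].
  by exists (Definiens f).
case/and3P=> /eqP -> /fraction_okP[a <-] /nilP' ->.
by exists (Assess n a).
Qed.

Lemma section_okP b n g :
  reflect (exists l : seq 'I_n, section_group b l = g) (section_ok b (names n) g).
Proof.
apply: (iffP andP) => [[]|[l <-]] /=; last first.
  split=> //; rewrite all_map; apply/allP=> i _ /=.
  by rewrite /assign_ok /= !eqxx /=; apply/namesP; exists i.
case: g => c l /= /eqP -> hl; rewrite /section_group.
suff [l' <-] : exists l' : seq 'I_n, map (assign_chunk b) l' = l by exists l'.
elim: l hl => [|[k s] l IH] /=; first by exists [::].
case/andP=> /and3P[/= /eqP -> hs /namesP[i hi]] /IH[l' <-]; exists (i :: l').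
case: s hs hi => [|a s] /=; first by case: b {IH} => /eqP.
by move=> /eqP -> ->.
Qed.

Lemma last_groups s x y z : let gs := s ++ [:: x; y; z] in
  [/\ last_group gs = z, evidence_group gs = y, query_group gs = x &
      clause_groups gs = s].
Proof.
rewrite /last_group /evidence_group /query_group /clause_groups rev_cat /=.
by rewrite revK.
Qed.

(** With fewer than three groups, [query_group] would be the default [no_group], whose head [SEnd]
    is not [SSection]. *)
Lemma groups_ok_split b ns gs : groups_ok b ns gs ->
  gs = clause_groups gs ++ [:: query_group gs; evidence_group gs; last_group gs].
Proof.
case/and3P=> /andP[/eqP hq _] _ _; move: hq.
rewrite /query_group /clause_groups /evidence_group /last_group.
have := revK gs; case: (rev gs) => [|z [|y [|x s]]] //= <- _.
by rewrite !rev_cons -!cats1 -!catA.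
Qed.

(** The clauses form a bare function, obtained by finite choice from the checks on single groups:
    acyclicity is not a matter of syntax and is tested separately. *)
Lemma groups_okP b gs :
  groups_ok b (names (size (clause_groups gs))) gs <->
  exists n (cl : 'I_n -> clause n) q e a,
    instance_groups b cl q e a = gs /\ forall i, clause_in b (cl i).
Proof.
split=> [h|[n [cl [q [e [a [<- hcl]]]]]]]; last first.
  have [h1 h2 h3 h4] := last_groups [seq clause_group (cl i) | i <- enum 'I_n]
    (section_group b q) (section_group b e) ((SSection, encode_fraction a), [::]).
  rewrite /groups_ok /instance_groups h1 h2 h3 h4 size_map size_enum_ord.
  have -> : section_ok b (names n) (section_group b q) by apply/section_okP; exists q.
  have -> : section_ok b (names n) (section_group b e) by apply/section_okP; exists e.
  have -> : fraction_ok (encode_fraction a) by apply/fraction_okP; exists a.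
  rewrite /= eqxx /=.
  rewrite all_map; apply/allP=> i _ /=.
  by apply/clause_okP; exists (cl i).
rewrite (groups_ok_split h); case/and5P: h.
move=> /section_okP[q <-] /section_okP[e <-] /eqP h1 /fraction_okP[a h2].
case/andP=> /nilP' h3 hc.
set n := size _ in q e hc *.
have h (i : 'I_n) : exists c : clause n, clause_in b c /\
    clause_group c = nth no_group (clause_groups gs) i.
  have /clause_okP[c h4 h5] := all_nthP no_group hc i (ltn_ord i).
  by exists c.
have [cl hcl] := fin_all_exists h.
exists n, cl, q, e, a; split; last by move=> i; case: (hcl i).
rewrite /instance_groups; congr (_ ++ _).
  rewrite (eq_map (fun i => (hcl i).2)).
  rewrite (map_comp (nth no_group (clause_groups gs)) val) val_enum_ord.
  exact: mkseq_nth.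
by congr [:: _; _; _]; move: h1 h2 h3; case: (last_group gs) => -[k s] l /= -> -> ->.
Qed.

(** * Marking computes reachability *)

Section Ancestors.

Context (b : bool) (n : nat) (cl : 'I_n -> clause n).

Local Notation nodes := (nodes_of b cl).
Local Notation enc := (fun i : 'I_n => encode_nat i).

Lemma enc_inj : injective enc.
Proof. by move=> i j /encode_nat_inj /val_inj. Qed.

Lemma ancestorsE M : ancestors nodes M = iter (size nodes) (mark_all nodes) M.
Proof.
have gen l M' : foldl (fun M (_ : node) => mark_all nodes M) M' l =
    iter (size l) (mark_all nodes) M'.
  by elim: l M' => // nd l IH M'; rewrite [size _]/= iterSr -IH.
exact: gen.
Qed.

Lemma mark_sub M nd : {subset M <= mark M nd}.
Proof. by move=> s hs; rewrite /mark; case: ifP => // _; rewrite mem_cat hs orbT. Qed.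

Lemma mark_all_sub l M : {subset M <= mark_all l M}.
Proof.
elim: l M => [|nd l IH] M s hs //=; apply: IH; exact: mark_sub.
Qed.

(** Marks are never removed, so one round reaches the node of [k] with its mark still present,
    wherever it stands in the list. *)
Lemma mark_all_parent i k M : enc k \in M -> i \in parents cl k ->
  enc i \in mark_all nodes M.
Proof.
move=> hk hi; have := mem_enum 'I_n k; rewrite inE /nodes_of.
elim: (enum 'I_n) M hk => //= j l IH M hk; rewrite in_cons => /orP[/eqP <-|hl].
  apply: mark_all_sub; rewrite /mark /= hk mem_cat; apply/orP; left.
  by apply/mapP; exists i.
by apply: IH => //; apply: mark_sub.
Qed.

Lemma ancestors_above A i :
  (enc i \in ancestors nodes (map enc A)) = (i \in above cl A).
Proof.
rewrite inE ancestorsE; apply/idP/hasP => [|[a ha /connectP[p]]]; last first.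
  case/shortenP=> p' hp' up' _ ea.
  have szp : size p' < size nodes.
    rewrite size_map size_enum_ord -[X in _ < X](card_ord n).
    have := max_card (mem (i :: p')); rewrite (card_uniqP up') /=; exact.
  have mono m k M : m <= k -> {subset iter m (mark_all nodes) M <= iter k (mark_all nodes) M}.
    move=> /subnK <-; rewrite iterD; elim: (k - m) => // r IH s hs /=.
    by apply: mark_all_sub; apply: IH.
  apply: mono (ltnW szp) _ _; rewrite {szp}.
  elim: p' i hp' ea {up'} => [|k p' IH] i /=.
    by move=> _ <-; apply/mapP; exists a.
  rewrite edgeE => /andP[hik hp] ea.
  exact: mark_all_parent (IH _ hp ea) hik.
(* Soundness invariant: every marked string is the name of an ancestor. The index is existential
   because marks are strings. *)
pose inv (M : seq str) := forall s, s \in M ->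
  exists i, s = enc i /\ exists2 a, a \in A & connect (edge cl) i a.
have inv_mark M j : inv M -> inv (mark M (node_of b cl j)).
  move=> hM s; rewrite /mark /=; case: ifP => [hj|_]; last exact: hM.
  rewrite mem_cat => /orP[/mapP[k hk ->]|]; last exact: hM.
  exists k; split=> //; have [j' [/enc_inj <- [a ha hc]]] := hM _ hj.
  by exists a => //; apply: connect_trans hc; apply: connect1; rewrite edgeE.
have inv_all M : inv M -> inv (mark_all nodes M).
  rewrite /nodes_of; elim: (enum 'I_n) M => //= j l IH M hM.
  by apply: IH; apply: inv_mark.
have inv_iter m : inv (iter m (mark_all nodes) (map enc A)).
  elim: m => [|m IH] /=; last exact: inv_all.
  by move=> s /mapP[a ha ->]; exists a; split=> //; exists a.
by case/inv_iter=> j [/enc_inj -> [a ha hc]]; exists a.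
Qed.

Lemma acyclic_okE : acyclic_ok nodes = acyclic (edge cl).
Proof.
rewrite /acyclic_ok all_map; apply/allP/forallP => [h j|h i _].
  apply/forallP=> i; apply/implyP; rewrite edgeE => hj.
  have := h i (mem_enum _ _); rewrite /= ancestors_above inE; apply: contra => hc.
  by apply/hasP; exists j.
rewrite /= ancestors_above inE; apply/hasP=> -[j hj hc].
have /forallP /(_ i) := h j; rewrite edgeE hj /=; by rewrite hc.
Qed.

End Ancestors.

(** * The integer comparison decides the conditional probability *)

Section Verdict.

Import Order.TTheory GRing.Theory Num.Theory.
Local Open Scope ring_scope.

Definition num_of (b : bool) n (c : clause n) : nat := bval (weight b (clause_group c).1).1.
Definition den_of (b : bool) n (c : clause n) : nat := bval (weight b (clause_group c).1).2.

Lemma fractionP a : (0 < fden a)%N && (fnum a <= fden a)%N.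
Proof. by case: a. Qed.

Lemma weight_of b n (c : clause n) : (0 < den_of b c)%N /\
  clause_weight b c = (num_of b c)%:R / (den_of b c)%:R.
Proof.
rewrite /num_of /den_of; case: c => [f|a] /=; rewrite /weight /=.
  by case: eqP => //= _; rewrite divr1.
have [-> ->] := read_fraction a; rewrite eqxx /=.
have /andP[h0 h1] := fractionP a; rewrite nat_bitsK; split=> //.
have nz : (fden a)%:R != 0 :> rat by rewrite pnatr_eq0 -lt0n.
case: b; rewrite /value /= ?nat_bitsK //.
by rewrite bval_sub !nat_bitsK // natrB // mulrBl divff.
Qed.

Lemma clause_weight_gt0 b n (c : clause n) : (0 < clause_weight b c) = (0 < num_of b c)%N.
Proof.
have [hd ->] := weight_of b c.
by rewrite pmulr_lgt0 ?ltr0n // invr_gt0 ltr0n.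
Qed.

Context (b : bool) (n : nat) (B : specification n).
Hypothesis hB : forced_by b (clause_of B).

Local Notation cl := (clause_of B).
Local Notation enc := (fun i : 'I_n => encode_nat i).
Local Notation Pr_all A := (Pr B (event [seq (i, b) | i <- A])).
Local Notation wt i := (clause_weight b (cl i)).

(** All weights are nonnegative, so their product is positive exactly when no numerator vanishes. *)
Lemma positive_okE e :
  positive_ok (nodes_of b cl) (ancestors (nodes_of b cl) (map enc e)) = (0 < Pr_all e).
Proof.
rewrite (Pr_forced _ hB) /positive_ok all_map.
apply/allP/idP => [h|h i _] /=.
  apply: prodr_gt0 => i hi; rewrite clause_weight_gt0 -bval_gt0.
  by have := h i (mem_enum _ _); rewrite /= ancestors_above hi.
rewrite ancestors_above; apply/implyP=> hi; rewrite bval_gt0 -/(num_of b (cl i)).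
rewrite -clause_weight_gt0 lt0r; apply/andP; split.
  by apply: contraTneq h => h0; rewrite (bigD1 i) //= h0 mul0r ltxx.
have [_ ->] := weight_of b (cl i); exact: divr_ge0.
Qed.

Lemma Pr_both q e : Pr B (predI (event [seq (i, b) | i <- q]) (event [seq (i, b) | i <- e])) =
  Pr_all e * \prod_(i | (i \in above cl (q ++ e)) && ~~ (i \in above cl e)) wt i.
Proof.
have -> : Pr B (predI (event [seq (i, b) | i <- q]) (event [seq (i, b) | i <- e])) =
    Pr_all (q ++ e).
  by apply: eq_bigl => w; rewrite /event map_cat all_cat.
rewrite !(Pr_forced _ hB) (bigID (mem (above cl e))) /=; congr (_ * _).
apply: eq_bigl => i; rewrite !inE has_cat andb_orl andbb.
by case: (has _ e); rewrite ?andbF ?orbT.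
Qed.

Lemma exceedsE (P : pred 'I_n) a :
  exceeds (map (node_of b cl) [seq i <- enum 'I_n | P i]) (nat_bits (fnum a))
    (nat_bits (fden a)) = (value a < \prod_(i | P i) wt i).
Proof.
have prodE (F : node -> bits) :
    bval (product [seq F nd | nd <- map (node_of b cl) [seq i <- enum 'I_n | P i]]) =
    (\prod_(i | P i) bval (F (node_of b cl i)))%N.
  by rewrite bval_product -map_comp big_map big_filter big_enum_cond; apply: eq_bigl.
rewrite /exceeds lebE ![product (_ :: _)]/= !bval_mul !nat_bitsK !prodE.
rewrite [X in _ < X](eq_bigr _ (fun i _ => (weight_of b (cl i)).2)).
rewrite big_split /= prodfV -!natr_prod.
have /andP[h0 _] := fractionP a; rewrite /value.
have hD : (0 < \prod_(i | P i) den_of b (cl i))%N.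
  by apply: prodn_gt0 => i; case: (weight_of b (cl i)).
rewrite ltr_pdivrMr ?ltr0n // mulrAC ltr_pdivlMr ?ltr0n // -!natrM ltr_nat.
by rewrite [X in _ = (_ < X)%N]mulnC.
Qed.

Lemma decide_coreE q e a : acyclic_ok (nodes_of b cl) ->
  decide_core (nodes_of b cl) (map enc q) (map enc e) (nat_bits (fnum a)) (nat_bits (fden a)) <->
  0 < Pr_all e /\ value a <
   Pr B (predI (event [seq (i, b) | i <- q]) (event [seq (i, b) | i <- e])) / Pr_all e.
Proof.
move=> hac; rewrite /decide_core hac positive_okE /= -map_cat.
have -> : relevant (nodes_of b cl) (ancestors (nodes_of b cl) (map enc (q ++ e)))
    (ancestors (nodes_of b cl) (map enc e)) =
    map (node_of b cl) [seq i <- enum 'I_n |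
      (i \in above cl (q ++ e)) && ~~ (i \in above cl e)].
  rewrite /relevant filter_map; congr map; apply: eq_filter => i /=.
  by rewrite !ancestors_above.
rewrite exceedsE Pr_both; split=> [/andP[h1 h2]|[h1 h2]].
  by split=> //; rewrite mulrAC divff ?mul1r // lt0r_neq0.
by rewrite h1; move: h2; rewrite mulrAC divff ?mul1r // lt0r_neq0.
Qed.

End Verdict.

Lemma forced_in_language b n (cl : 'I_n -> clause n) :
  (forall i, clause_in b (cl i)) -> forced_by b cl.
Proof. by move=> h i f e; apply: eval_in_language; have := h i; rewrite e. Qed.

Lemma assigned_section b n (l : seq 'I_n) :
  assigned (section_group b l) = [seq encode_nat (i : 'I_n) | i <- l].
Proof. by rewrite /assigned /= -map_comp. Qed.

Lemma decide_groups b n (cl : 'I_n -> clause n) q e a :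
  (forall i, clause_in b (cl i)) ->
  decide b (flat (flat (instance_groups b cl q e a))) =
  decide_core (nodes_of b cl) [seq encode_nat (i : 'I_n) | i <- q]
    [seq encode_nat (i : 'I_n) | i <- e] (nat_bits (fnum a)) (nat_bits (fden a)).
Proof.
move=> hcl; have hg := instance_groups_ok b cl q e a.
have [h1 h2 h3 h4] := last_groups [seq clause_group (cl i) | i <- enum 'I_n]
  (section_group b q) (section_group b e) ((SSection, encode_fraction a), [::]).
have [hn hd] := read_fraction a.
rewrite /decide /well_formed (groups_flat hg).
have [-> ->] := cut_groups hg; rewrite /= names_of_mk_nodes.
have -> /= : groups_ok b (names (size (clause_groups (instance_groups b cl q e a))))
    (instance_groups b cl q e a).
  by apply/groups_okP; exists n, cl, q, e, a.
by rewrite h1 h2 h3 h4 mk_nodes_clauses !assigned_section hn hd.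
Qed.

Lemma bodies_inP b n (B : specification n) :
  bodies_in (Prop_language [:: op b]) B <-> (forall i, clause_in b (clause_of B i)).
Proof.
split=> [h i|h i f e]; last by have := h i; rewrite e.
by case e: (clause_of B i) => [f|//]; apply: h e.
Qed.

Theorem decide_correct b s : decide b s <->
  strings (fun x => INF (Prop_language [:: op b]) x /\ only_assigns b x) s.
Proof.
split=> [|[x <- [[hL hpos hlt] hb]]].
  move=> hs; have /andP[hw _] := hs; have es := well_formed_flat hw.
  case/and3P: hw => _ _; rewrite names_of_mk_nodes => /groups_okP[n [cl [q [e [a [eg hcl]]]]]].
  rewrite es -eg decide_groups // in hs.
  have hac : acyclic_ok (nodes_of b cl) by case/and3P: hs.
  have ac := hac; rewrite acyclic_okE in ac.
  (* The acyclicity test supplies the proof that turns the parsed clauses into a specification. *)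
  pose B := Specification ac.
  have [hpos hlt] := (decide_coreE (forced_in_language hcl : forced_by b (clause_of B)) q e a hac).1 hs.
  exists (Instance B [seq (i, b) | i <- q] [seq (i, b) | i <- e] a).
    by rewrite encodeE eg -es.
  split; first by split=> //; apply/bodies_inP.
  by rewrite /only_assigns -map_cat all_map; apply/allP=> i _ /=.
case: x hL hpos hlt hb => n B Q E a /= hL hpos hlt.
rewrite /only_assigns /= all_cat => /andP[hQ hE].
(* One-sided assignments are determined by their variables, which brings the instance into the form
   of [encodeE]. *)
have rebuild (A : seq (assignment n)) : all (fun a => a.2 == b) A ->
    A = [seq (i, b) | i <- map fst A].
  by elim: A => //= -[i c] A IH /andP[/= /eqP -> /IH <-].
rewrite (rebuild Q hQ) (rebuild E hE) in hpos hlt *.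
have /bodies_inP hcl := hL.
rewrite encodeE decide_groups //; apply/(decide_coreE (forced_in_language hcl)) => //.
by rewrite acyclic_okE; case: B {hL hpos hlt hcl}.
Qed.

Theorem theorem1 :
  in_P (strings (fun x => INF (Prop_language [:: Conj]) x /\ only_assigns true x)) /\
  in_P (strings (fun x => INF (Prop_language [:: Disj]) x /\ only_assigns false x)).
Proof.
split; [apply: (pt_in_P (pt_decide true)) | apply: (pt_in_P (pt_decide false))].
- exact: (decide_correct true).
- exact: (decide_correct false).
Qed.
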